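(* Let $F$ be an algebraically closed field of characteristic $0$, let $n\ge 2$, and let $\mathfrak{sl}(n+1,F)=\bigoplus_{i=1}^m\mathfrak g_i$ be a regular decomposition of type $(m,k)$. Then: 1. $(m,k)=(k+1,k)$ or $(m,k)=(k,k)$. 2. If $m\ge 3$ and $(m,k)=(k+1,k)$, then up to equivalence the decomposition is of the form $$\mathfrak g_1=\mathrm{span}_F\{E_{1,j}\mid 2\le j\le n+1\},$$ $$\mathfrak g_\ell=\mathrm{span}_F\Big\{E_{i+1,j},\ H_i\ \Big|\ \sum_{t=1}^{\ell-2}\lambda_t<i\le\sum_{t=1}^{\ell-1}\lambda_t,\ 1\le j\le n+1,\ j\neq i+1\Big\},\qquad 2\le\ell\le k+1,$$ where $(\lambda_1,\dots,\lambda_k)$ is a $k$-partition of $n$. 3. If $m\ge 3$ and $(m,k)=(k,k)$, then up to equivalence the decomposition is given by $$\mathfrak g_1=\mathrm{span}_F\{E_{i+1,j},\ H_i,\ X\mid 0\le i\le\lambda_1,\ 1\le j\le n+1,\ j\neq i+1\},$$ $$\mathfrak g_\ell=\mathrm{span}_F\Big\{E_{i+1,j},\ H_i-X\ \Big|\ \sum_{t=1}^{\ell-1}\lambda_t<i\le\sum_{t=1}^{\ell}\lambda_t,\ 1\le j\le n+1,\ j\neq i+1\Big\},\qquad 2\le\ell\le k,$$ where $(\lambda_1,\dots,\lambda_k)$ is a $k$-partition of $n$ and $X$ is an arbitrary element (i.e. any element may occur) of the set $$\mathrm{span}_F\{H_1,\dots,H_{\lambda_1}\}\ \cup\ \Big\{H_p\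 \Big|\ 2\le q\le k,\ \lambda_q>1,\ \sum_{t=1}^{q-1}\lambda_t<p\le\sum_{t=1}^{q}\lambda_t\Big\}.$$
   Context: $\mathfrak{sl}(n+1,F)$ is the Lie algebra of traceless $(n+1)\times(n+1)$ matrices over $F$, $\mathfrak h$ is its Cartan subalgebra of diagonal matrices, $\Delta$ is its root system with respect to $\mathfrak h$, and $\mathfrak g_\alpha$ ($\alpha\in\Delta$) are the root spaces. $E_{i,j}$ is the matrix with $1$ in position $(i,j)$ and $0$ elsewhere, and $H_i=E_{1,1}-E_{i+1,i+1}$ for $0\le i\le n$ (so $H_0=0$). For $m\ge2$, an $m$-regular decomposition of $\mathfrak g$ is a direct sum decomposition (of vector spaces) $\mathfrak g=\bigoplus_{i=1}^m\mathfrak g_i$ with nonzero summands such that all $\mathfrak g_i$ and all $\mathfrak g_i\oplus\mathfrak g_j$ ($i\ne j$) are Lie subalgebras, and each $\mathfrak g_i$ has the form $\mathfrak s_i\oplus\bigoplus_{\alpha\in\Delta_i}\mathfrak g_\alpha$ for some subspace $\mathfrak s_i\subseteq\mathfrak h$ and some subset $\Delta_i\subseteq\Delta$. It is of type $(m,k)$ if exactly $k$ of the subspaces $\mathfrak s_i$ are nonzero. Equivalence of regular decompositions is generated by: swapping positive and negative roots (applying the automorphism $A\mapsto -A^{T}$ to all summands), re-numbering the summands $\mathfrak g_i$, and the action of the Weyl group $W(A_n)\cong S_{n+1}$ (simultaneous conjugation of all summands by a permutation matrix). A $k$-partition of a positive integer $N$ is a tuple $(\lambda_1,\dots,\lambda_k)$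 of positive integers with sum $N$; no monotonicity of the entries is imposed. *)

(* Defs.v *)
From mathcomp Require Import all_boot all_order all_algebra perm.
From Stdlib Require Export Relation_Operators.

Set Implicit Arguments.
Unset Strict Implicit.
Unset Printing Implicit Defensive.

Import GRing.Theory.
Local Open Scope ring_scope.

Section SpecialLinear.

Variables (F : fieldType) (n : nat).
Implicit Types (x y h A : 'M[F]_n) (U V : {vspace 'M[F]_n}).

Definition lie_bracket x y : 'M[F]_n := x *m y - y *m x.

Definition ad x : 'End('M[F]_n) := linfun (mulmx x) - linfun (mulmxr x).

Lemma adE x y : ad x y = lie_bracket x y.
Proof. by rewrite /ad add_lfunE opp_lfunE !lfunE. Qed.

Definition sl : {vspace 'M[F]_n} :=
  lker (linfun (mxtrace : 'M[F]_n -> F^o)).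

Lemma mem_sl A : (A \in sl) = (\tr A == 0).
Proof.
rewrite memv_ker (lfunE (GRing.Linear.clone _ _ _ _ (mxtrace : 'M[F]_n -> F^o) _)).
by [].
Qed.

Definition cartan : {vspace 'M[F]_n} :=
  (sl :&: limg (linfun (@diag_mx F n)))%VS.

Lemma mem_cartan A : (A \in cartan) = is_diag_mx A && (\tr A == 0).
Proof.
rewrite memv_cap mem_sl andbC; congr (_ && _).
apply/memv_imgP/is_diag_mxP => [[d _ ->] i j neq_ij | diagA].
  by rewrite lfunE mxE (negPf (_ : i != j)).
exists (\row_j A j j); first exact: memvf.
apply/matrixP=> i j; rewrite lfunE !mxE; case: eqVneq => [->|neq_ij] //.
by rewrite diagA.
Qed.

Definition lie_subalgebra U : Prop :=
  (U <= sl)%VS /\ (forall x y, x \in U -> y \in U -> lie_bracket x y \in U).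

(* Weights live in the dual of the Cartan subalgebra. *)
Definition weight : Type := 'Hom(subvs_of cartan, F^o).

Definition root_space (a : weight) : {vspace 'M[F]_n} :=
  (sl :&: \bigcap_(h <- vbasis {: subvs_of cartan})
            passmx.leigenspace (ad (vsval h)) (a h))%VS.

Lemma root_spaceP (a : weight) x :
  reflect (x \in sl /\ forall h : subvs_of cartan,
             lie_bracket (vsval h) x = (a h : F) *: x)
          (x \in root_space a).
Proof.
have eigE (h : subvs_of cartan) :
    (x \in passmx.leigenspace (ad (vsval h)) (a h)) =
    (lie_bracket (vsval h) x == (a h : F) *: x).
  rewrite memv_ker add_lfunE opp_lfunE scale_lfunE id_lfunE adE.
  by rewrite subr_eq0.
rewrite memv_cap; apply: (iffP andP) => -[xsl xE]; split=> //.
  move=> h; pose b := vbasis {: subvs_of cartan}.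
  have bE i : lie_bracket (vsval b`_i) x = (a b`_i : F) *: x.
    case: (ltnP i (size b)) => [ltib | leib]; last first.
      rewrite nth_default // !linear0 scale0r /lie_bracket.
      by rewrite mul0mx mulmx0 subrr.
    apply/eqP; rewrite -eigE; have := mem_nth 0 ltib.
    move: xE; rewrite big_seq; move: (b`_i) => v xE vb.
    by move: xE; rewrite -big_seq (big_rem v vb) /= memv_cap => /andP[].
  rewrite (coord_vbasis (memvf h)) !linear_sum /= scaler_suml /lie_bracket.
  rewrite mulmx_suml mulmx_sumr -sumrB; apply: eq_bigr => i _.
  rewrite !linearZ /= -scalemxAl -scalerDr -/(lie_bracket _ _) bE.
  by rewrite scalerA.
elim/big_ind: _ => [|U V xU xV|h _]; first exact: memvf.
  by rewrite memv_cap xU xV.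
by rewrite eigE xE.
Qed.

Definition is_root (a : weight) : bool := (a != 0) && (root_space a != 0%VS).

(* D lists, without repetition, the chosen subset of the finite root system. *)
Definition regular_form (s : {vspace 'M[F]_n}) (D : seq weight) V : Prop :=
  [/\ (s <= cartan)%VS,
      uniq D /\ all is_root D,
      directv (s + \sum_(a <- D) root_space a)%VS &
      V = (s + \sum_(a <- D) root_space a)%VS].

Definition regular_decomposition (m k : nat) (g : 'I_m -> {vspace 'M[F]_n}) :
    Prop :=
  [/\ (2 <= m)%N,
      directv (\sum_i g i)%VS /\ (\sum_i g i)%VS = sl,
      (forall i, g i != 0%VS),
      (forall i, lie_subalgebra (g i)) /\
      (forall i j, i != j -> lie_subalgebra (g i + g j)%VS) &
      exists (s : 'I_m -> {vspace 'M[F]_n}) (D : 'I_m -> seq weight),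
        (forall i, regular_form (s i) (D i) (g i)) /\
        #|[set i | s i != 0%VS]| = k].

Definition neg_trmx : 'End('M[F]_n) := - linfun (@trmx F n n).

Definition perm_conj (w : 'S_n) : 'End('M[F]_n) :=
  linfun (mulmx (perm_mx w) \o mulmxr (invmx (perm_mx w))).

Inductive equivalence_step (m : nat) (g g' : 'I_m -> {vspace 'M[F]_n}) :
    Prop :=
| StepSwap of forall i, g' i = (neg_trmx @: g i)%VS
| StepRenumber (t : 'S_m) of forall i, g' i = g (t i)
| StepWeyl (w : 'S_n) of forall i, g' i = (perm_conj w @: g i)%VS.

Definition equivalent (m : nat) (g g' : 'I_m -> {vspace 'M[F]_n}) : Prop :=
  clos_refl_sym_trans _ (@equivalence_step m) g g'.

End SpecialLinear.

Definition is_partition (N : nat) (lam : seq nat) : Prop :=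
  all (leq 1) lam /\ sumn lam = N.

(* lam_1 + ... + lam_q < i <= lam_1 + ... + lam_(q+1) for 1-based lam_t *)
Definition block (lam : seq nat) (q i : nat) : bool :=
  (sumn (take q lam) < i <= sumn (take q.+1 lam))%N.

Section NormalForms.

(* Rows and columns are numbered from 0, so that E_(i+1,j+1) is Emat i j below;
   the summand g_(l+1) is the value at l. *)
Variables (F : fieldType) (n : nat).

Definition Emat (i j : 'I_n.+1) : 'M[F]_n.+1 := delta_mx i j.

Definition Hmat (i : 'I_n.+1) : 'M[F]_n.+1 := Emat ord0 ord0 - Emat i i.

Definition root_vectors (P : pred 'I_n.+1) : seq 'M[F]_n.+1 :=
  [seq Emat i j | i <- enum P, j <- enum (predC1 i)].

Definition normal_form_succ (lam : seq nat) (l : nat) : {vspace 'M[F]_n.+1} :=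
  if l is l'.+1 then
    let P := [pred i : 'I_n.+1 | block lam l' i] in
    <<root_vectors P ++ [seq Hmat i | i in P]>>%VS
  else <<[seq Emat ord0 j | j in predC1 ord0]>>%VS.

Definition normal_form_eq (lam : seq nat) (X : 'M[F]_n.+1) (l : nat) :
    {vspace 'M[F]_n.+1} :=
  if l == 0%N then
    let P := [pred i : 'I_n.+1 | i <= nth 0 lam 0]%N in
    <<X :: root_vectors P ++ [seq Hmat i | i in P]>>%VS
  else
    let P := [pred i : 'I_n.+1 | block lam l i] in
    <<root_vectors P ++ [seq Hmat i - X | i in P]>>%VS.

Definition admissible (k : nat) (lam : seq nat) (X : 'M[F]_n.+1) : Prop :=
  X \in <<[seq Hmat i | i in [pred i : 'I_n.+1 | 1 <= i <= nth 0 lam 0]%N]>>%VS \/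
  exists (q : nat) (p : 'I_n.+1),
    [/\ (1 <= q < k)%N, (1 < nth 0 lam q)%N, block lam q p & X = Hmat p].

End NormalForms.

(* Main.v *)
Require Import Defs.
From HB Require Import structures.
From mathcomp Require Import all_boot all_order all_algebra perm.

(** Colour the root vector E_ij by the index c(i,j) of the summand containing
    it. Closure of the pairwise sums of summands gives c(i,k) in
    {c(i,j), c(j,k)}: around the hexagon ij, ik, jk, ji, ki, kj every entry
    agrees with a neighbour. If c(i,j) <> c(j,i) for some pair, an entry of a
    third colour yields a triple with three colours, which is constant along
    its rows or along its columns, and this propagates to all indices; so with
    at least three colours c depends only on the row or only on the column, and
    A |-> -A^T exchanges the two cases.

    Let r(i) be the colour of row i and s_l the Cartan part of the summand l.
    Since e_i - e_j lies in s_(r i) + s_(r j), there is a single diagonal W of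
    trace 1 such that s_l is spanned by the e_i - W with r(i) = l. The relation
    sum_i W_ii (e_i - W) = 0 splits along the direct sum of the s_l, which
    forces W to be supported on the rows of one colour l0. Hence s_l <> 0 for
    l <> l0, and s_l0 = 0 iff l0 has a single row. Sorting the rows by colour,
    with l0 first, gives the normal forms, with X = e_0 - W. *)

Set Implicit Arguments.
Unset Strict Implicit.
Unset Printing Implicit Defensive.

Import GRing.Theory.
Local Open Scope ring_scope.

(** * Colourings of ordered pairs *)

Section Colouring.

Local Open Scope nat_scope.

Variables (I : finType) (C : eqType).
Implicit Types (c : I -> I -> C) (i j k x y : I).

(** Reflects [[E_ij, E_jk] = E_ik]: the sum of the two summands holding the factors is closed under
    the bracket, so [E_ik] lies in one of them. *)
Definition closed_colouring c :=
  forall i j k, i <> j -> j <> k -> i <> k -> c i k = c i j \/ c i k = c j k.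

(** The seed of the propagation: three rows, each of one colour on the triple, with three different
    colours. *)
Definition row_triple c i j k :=
  [/\ [/\ i <> j, j <> k & i <> k],
      [/\ c i k = c i j, c j k = c j i & c k j = c k i] &
      [/\ c i j <> c j i, c j i <> c k i & c i j <> c k i]].

Definition row_colouring c := exists r, forall i j, i <> j -> c i j = r i.

Lemma closed_colouring_tr c :
  closed_colouring c -> closed_colouring (fun i j => c j i).
Proof.
move=> clc i j k nij njk nik.
have [||||] := clc k j i; do ?by [exact/nesym | left | right].
Qed.

(** A fourth index must join the pattern: otherwise closure through [x] would identify two of the
    three row colours. *)
Lemma row_triple_extend c i j k x : closed_colouring c -> row_triple c i j k ->
  x <> i -> x <> j -> x <> k ->
  [/\ c i x = c i j, c j x = c j i & c k x = c k i] /\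
  (c x j = c x i /\ c x k = c x i).
Proof.
move=> clc [[nij njk nik] [eik ejk ekj] [dij djk dik]] nxi nxj nxk.
have law p q : p <> q -> q <> x -> p <> x ->
  [/\ c p q = c p x \/ c p q = c x q, c p x = c p q \/ c p x = c q x
    & c x p = c x q \/ c x p = c q p].
  by move=> pq qx px; split; apply: clc; exact/nesym || done.
have [nix njx nkx] : [/\ i <> x, j <> x & k <> x] by split; exact/nesym.
have [nji nkj nki] : [/\ j <> i, k <> j & k <> i] by split; exact/nesym.
have [ij1 ij2 ij3] := law i j nij njx nix.
have [ji1 ji2 ji3] := law j i nji nix njx.
have [ik1 ik2 ik3] := law i k nik nkx nix.
have [ki1 ki2 ki3] := law k i nki nix nkx.
have [jk1 jk2 jk3] := law j k njk nkx njx.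
have [kj1 kj2 kj3] := law k j nkj njx nkx.
rewrite ?eik ?ejk ?ekj in ij1 ij2 ij3 ji1 ji2 ji3 ik1 ik2 ik3 ki1 ki2 ki3.
rewrite ?eik ?ejk ?ekj in jk1 jk2 jk3 kj1 kj2 kj3.
(* In the first use [a], [b], [d] are the colours of rows [i], [j], [k]; [p], [q], [s] the entries
   of these rows in column [x]; [Q], [S] the entries [x j], [x k]. If [p <> a], then [p = q = s] and
   [a = Q = S], hence [b = q] and [d = s], against [b <> d]. *)
have row (a b d p q s Q S : C) : b <> d -> a <> b -> a <> d ->
    p = a \/ p = q -> p = a \/ p = s -> a = p \/ a = Q -> a = p \/ a = S ->
    b = q \/ b = S -> d = s \/ d = Q -> p = a.
  clear=> ? ? ? [] // ? [] // ? [] // ? [] // ? [] ? [] ?; congruence.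
have [dji dkj dki] : [/\ c j i <> c i j, c k i <> c j i & c k i <> c i j].
  by split; exact/nesym.
have pi := row _ _ _ _ _ _ _ _ djk dij dik ij2 ik2 ij1 ik1 jk1 kj1.
have pj := row _ _ _ _ _ _ _ _ dik dji djk ji2 jk2 ji1 jk1 ik1 ki1.
have pk := row _ _ _ _ _ _ _ _ dij dki dkj ki2 kj2 ki1 kj1 ij1 ji1.
split; first by [].
(* If two entries of row [x] differ, say at [i] and [j], closure makes them [c j i] and [c i j]; the
   entry [x k] is then compatible with at most one of them. *)
move: ij3 ji3 ik3 ki3 jk3 kj3 dij djk dik; clear.
by case=> ?; case=> ?; case=> ?; case=> ?; case=> ?; case=> *; split;
  congruence.
Qed.

(** Entries between two new indices are reached by exchanging an index of the triple for the new row
    and extending once more. *)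
Lemma row_triple_row c i j k : closed_colouring c -> row_triple c i j k ->
  row_colouring c.
Proof.
move=> clc rt; have [[nij njk nik] [eik ejk ekj] [dij djk dik]] := rt.
(* The colour of a row is read in column [i], except for row [i] itself, which is read in column
   [j]. *)
exists (fun x => if x == i then c i j else c x i) => x y nxy.
have ext z := row_triple_extend (x := z) clc rt.
have [ex | /eqP nxi] := eqVneq x i.
  rewrite ex in nxy *.
  have [-> // | /eqP nyj] := eqVneq y j.
  have [-> // | /eqP nyk] := eqVneq y k.
  by have [[->]] := ext y (nesym nxy) nyj nyk.
have [-> // | /eqP nyi] := eqVneq y i.
have [ex | /eqP nxj] := eqVneq x j.
  rewrite ex in nxy *; have [-> // | /eqP nyk] := eqVneq y k.
  by case: (ext y nyi (nesym nxy) nyk) => [[]].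
have [ex | /eqP nxk] := eqVneq x k.
  rewrite ex in nxy *; have [-> // | /eqP nyj] := eqVneq y j.
  by case: (ext y nyi nyj (nesym nxy)) => [[]].
have [[pi pj pk] [xj xk]] := ext x nxi nxj nxk.
have [-> // | /eqP nyj] := eqVneq y j.
have [-> // | /eqP nyk] := eqVneq y k.
have [nix njx nkx] : [/\ i <> x, j <> x & k <> x] by split; exact/nesym.
have [nji nkj nki] : [/\ j <> i, k <> j & k <> i] by split; exact/nesym.
(* Two old indices whose row colours avoid that of row [x] form a row triple with [x], which then
   extends to [y]. *)
have sub p q : p <> q -> p <> x -> q <> x -> c p x = c p q -> c q x = c q p ->
    c x q = c x p -> c p q <> c q p -> c p q <> c x p -> c q p <> c x p ->
    y <> p -> y <> q -> c x y = c x p.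
  move=> npq npx nqx epx eqx exq d1 d2 d3 nyp nyq.
  have rt' : row_triple c p q x by split; split.
  by have [[_ _ ->]] := row_triple_extend clc rt' nyp nyq (nesym nxy).
(* Row [x] shares its colour with at most one of the three old rows; the other two are kept, and if
   it agrees with neither row [i] nor row [j], these are the ones kept. *)
have [e1 | /eqP n1] := eqVneq (c x i) (c i j).
  have := sub j k njk njx nkx; rewrite xj ejk ekj pj pk xk; apply => //;
    congruence.
have [e2 | /eqP n2] := eqVneq (c x i) (c j i).
  have := sub i k nik nix nkx; rewrite eik; apply => //; congruence.
by apply: (sub i j) => //; exact/nesym.
Qed.

(** Closure around the hexagon leaves only [c y j = c i j], [c j y = c i y] and [c y i = c j i], a
    row triple of the transposed colouring. *)
Lemma three_coloured_triple c i j y : closed_colouring c ->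
  i <> j -> y <> i -> y <> j -> c i j <> c j i ->
  c i y <> c i j -> c i y <> c j i -> row_colouring (fun i j => c j i).
Proof.
move=> clc nij nyi nyj dij d1 d2.
apply: (@row_triple_row _ i j y (closed_colouring_tr clc)).
have [nji niy njy] : [/\ j <> i, i <> y & j <> y] by split; exact/nesym.
have := clc i y j niy nyj nij; have := clc i j y nij njy niy.
have := clc j i y nji niy njy; have := clc j y i njy nyi nji.
move: dij d1 d2; clear - nij niy njy.
move=> dij d1 d2 [?|?] [?|?] [?|?] [?|?]; try congruence;
  by split; split => //; congruence.
Qed.

(** A third colour next to an asymmetric pair produces a three-coloured triple; with no asymmetric
    pair, closure makes [c] constant. *)
Lemma three_colouring c : closed_colouring c ->
  (forall s : seq C, size s < 3 -> exists i j, i <> j /\ c i j \notin s) ->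
  row_colouring c \/ row_colouring (fun i j => c j i).
Proof.
move=> clc three.
have clt := closed_colouring_tr clc.
have key i j z : i <> j -> z <> i -> z <> j -> c i j <> c j i ->
    [\/ c i z <> c i j /\ c i z <> c j i, c j z <> c i j /\ c j z <> c j i,
        c z i <> c i j /\ c z i <> c j i | c z j <> c i j /\ c z j <> c j i] ->
    row_colouring c \/ row_colouring (fun i j => c j i).
  move=> nij nzi nzj dij [[d1 d2]|[d1 d2]|[d1 d2]|[d1 d2]].
  - by right; apply: (three_coloured_triple (i := i) (j := j) (y := z)).
  - right; apply: (three_coloured_triple (i := j) (j := i) (y := z)) => //;
      exact/nesym.
  - left; apply: (three_coloured_triple (i := i) (j := j) (y := z) clt) => //;
      exact/nesym.
  - left; apply: (three_coloured_triple (i := j) (j := i) (y := z) clt) => //;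
      exact/nesym.
have asym i j : i <> j -> c i j <> c j i ->
    row_colouring c \/ row_colouring (fun i j => c j i).
  move=> nij dij; have [x [y [nxy]]] := three [:: c i j; c j i] isT.
  rewrite !inE negb_or => /andP[/eqP dx /eqP dy].
  have nji := nesym nij.
  have [ex | /eqP nxi] := eqVneq x i.
    rewrite ex in nxy dx dy; apply: (key i j y nij (nesym nxy)) => //.
      by move=> ey; rewrite ey in dx.
    by constructor 1.
  have [ex | /eqP nxj] := eqVneq x j.
    rewrite ex in nxy dx dy; apply: (key i j y nij _ (nesym nxy)) => //.
      by move=> ey; rewrite ey in dy.
    by constructor 2.
  have [ey | /eqP nyi] := eqVneq y i.
    rewrite ey in dx dy; apply: (key i j x) => //; by constructor 3.
  have [ey | /eqP nyj] := eqVneq y j.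
    rewrite ey in dx dy; apply: (key i j x) => //; by constructor 4.
  (* A third colour on an entry disjoint from [i] and [j] is passed by closure to [x i] or to
     [i y]. *)
  have [e | e] := clc x i y nxi (nesym nyi) nxy; rewrite e in dx dy.
    by apply: (key i j x) => //; constructor 3.
  by apply: (key i j y) => //; constructor 1.
have [/existsP[i /existsP[j /andP[/eqP nij /eqP dij]]] | none] :=
    boolP [exists i, exists j, (i != j) && (c i j != c j i)].
  exact: (asym i j).
have sym i j : i <> j -> c i j = c j i.
  move=> /eqP nij; apply/eqP; apply: contraNT none => dij.
  by apply/existsP; exists i; apply/existsP; exists j; rewrite nij.
(* In a symmetric colouring each edge of a triangle shares its colour with another edge, so all
   three agree. *)
have mono i j k : i <> j -> j <> k -> i <> k -> c i j = c i k.
  move=> nij njk nik; have := clc i j k nij njk nik.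
  have := clc i k j nik (nesym njk) nij; have := clc j i k (nesym nij) nik njk.
  rewrite (sym j i (nesym nij)) (sym k j (nesym njk)).
  move=> [?|?] [?|?] [?|?]; congruence.
have [i [j [nij _]]] := three [::] isT.
have [x [y [nxy]]] := three [:: c i j] isT.
rewrite inE => /eqP []; apply: esym.
have [eix | /eqP nix] := eqVneq i x.
  subst x; have [-> // | /eqP njy] := eqVneq j y.
  by apply: mono.
have [eiy | /eqP niy] := eqVneq i y.
  subst y; rewrite (sym x i nxy); have [-> // | /eqP njx] := eqVneq j x.
  by apply: mono.
rewrite (sym x y nxy) -(mono y i x) ?(sym y i); try exact/nesym; last by [].
by have [-> // | /eqP njy] := eqVneq j y; apply: mono.
Qed.

End Colouring.

(** * Root spaces of sl(n) *)

Section Coordinates.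

Variables (F : fieldType) (n : nat).
Implicit Types (A B : 'M[F]_n) (P Q : rel 'I_n) (s : {vspace 'M[F]_n}).

Definition entry_mask Q A : 'M[F]_n := \matrix_(i, j) (A i j *+ Q i j).

Lemma entry_mask_is_linear Q : linear (entry_mask Q).
Proof.
by move=> a A B; apply/matrixP => i j; rewrite !mxE mulrnDl mulrnAr.
Qed.

HB.instance Definition _ Q :=
  GRing.isLinear.Build F 'M[F]_n 'M[F]_n _ (entry_mask Q) (entry_mask_is_linear
    Q).

Definition diag_part : 'M[F]_n -> 'M[F]_n := entry_mask (fun i j => i == j).

HB.instance Definition _ := GRing.Linear.on diag_part.

Lemma diag_partE A i j : diag_part A i j = A i j *+ (i == j).
Proof. exact: mxE. Qed.

Lemma cartan_diag A i j : A \in cartan F n -> i != j -> A i j = 0.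
Proof. by rewrite mem_cartan => /andP[/is_diag_mxP dA _]; apply: dA. Qed.

Lemma diag_part_id A : A \in cartan F n -> diag_part A = A.
Proof.
move=> Ah; apply/matrixP => i j; rewrite diag_partE.
by have [// | nij] := eqVneq i j; rewrite (cartan_diag Ah nij).
Qed.

Lemma diag_part_cartan A : \tr A = 0 -> diag_part A \in cartan F n.
Proof.
move=> trA; rewrite mem_cartan; apply/andP; split.
  by apply/is_diag_mxP => i j nij; rewrite diag_partE (negPf (_ : i != j)).
by rewrite -trA; apply/eqP/eq_bigr => i _; rewrite diag_partE eqxx.
Qed.

Lemma cartan_sl : (cartan F n <= sl F n)%VS.
Proof. exact: capvSl. Qed.

Lemma trace_cartan A : A \in cartan F n -> \tr A = 0.
Proof. by rewrite mem_cartan => /andP[_ /eqP]. Qed.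

(** Matrix form of a regular summand: the roots are encoded as pairs [(i, j)] with [i != j], and the
    root spaces as the lines through [E_ij]. *)
Definition weight_sum s P : {vspace 'M[F]_n} :=
  (s + <<[seq delta_mx p.1 p.2 |
           p <- enum [pred p : 'I_n * 'I_n | (p.1 != p.2) && P p.1 p.2]]>>)%VS.

Lemma mem_weight_sum s P A : (s <= cartan F n)%VS ->
  reflect (diag_part A \in s /\ (forall i j, i != j -> ~~ P i j -> A i j = 0))
          (A \in weight_sum s P).
Proof.
move=> sh; apply: (iffP memv_addP) => [[u us [v vX ->]] | [dA offA]].
  (* [Q] marks the positions where the root part must vanish; masking by [Q] kills every generator,
     hence the whole span. *)
  pose Q i j := (i == j) || ~~ P i j.
  have Qv : entry_mask Q v = 0.
    apply/eqP; rewrite -(lfunE (entry_mask Q)) -memv_ker.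
    apply: subvP vX; apply/span_subvP => _ /mapP[[i j] + ->].
    rewrite mem_enum inE /= => /andP[nij Pij]; rewrite memv_ker lfunE.
    apply/eqP/matrixP => k l; rewrite !mxE.
    case: andP => [[/eqP-> /eqP->] | _]; last by rewrite mul0rn.
    by rewrite /Q (negPf nij) Pij.
  have Qv0 i j : Q i j -> v i j = 0.
    by move=> Qij; move/matrixP/(_ i j): Qv; rewrite !mxE Qij.
  have uh := subvP sh _ us.
  split=> [|i j nij nP]; last first.
    by rewrite mxE (cartan_diag uh nij) Qv0 ?addr0 // /Q nP orbT.
  rewrite linearD /= (diag_part_id uh) (_ : diag_part v = 0) ?addr0 //.
  apply/matrixP => i j; rewrite diag_partE mxE.
  by have [-> | //] := eqVneq i j; rewrite Qv0 // /Q eqxx.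
exists (diag_part A) => //; exists (A - diag_part A); last first.
  by rewrite addrC subrK.
rewrite [A - _]matrix_sum_delta; apply: memv_suml => i _.
apply: memv_suml => j _; rewrite !mxE.
have [-> | nij] := eqVneq i j; first by rewrite subrr scale0r mem0v.
rewrite subr0; case: (boolP (P i j)) => [Pij | nP]; last first.
  by rewrite offA // scale0r mem0v.
apply: memvZ; apply: memv_span; apply/mapP; exists (i, j) => //.
by rewrite mem_enum inE /= nij.
Qed.

Lemma delta_offdiag_sl i j : i != j -> delta_mx i j \in sl F n.
Proof.
move=> nij; rewrite mem_sl; apply/eqP; apply: big1 => k _; rewrite mxE.
by have [-> | //] := eqVneq k i; rewrite (negPf nij).
Qed.

Lemma weight_sum_sl s P : (s <= cartan F n)%VS -> (weight_sum s P <= sl F n)%VS.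
Proof.
move=> sh; rewrite subv_add (subv_trans sh cartan_sl) /=.
apply/span_subvP => _ /mapP[[i j] + ->].
by rewrite mem_enum inE /= => /andP[nij _]; apply: delta_offdiag_sl.
Qed.

Lemma eq_weight_sum s P Q : (forall i j, i != j -> P i j = Q i j) ->
  weight_sum s P = weight_sum s Q.
Proof.
move=> eqPQ; congr (_ + <<map _ _>>)%VS; apply: eq_enum => -[i j].
by rewrite !inE /=; have [|/eqPQ->] := eqVneq i j.
Qed.

Lemma weight_sum_delta s P i j :
  i != j -> P i j -> delta_mx i j \in weight_sum s P.
Proof.
move=> nij Pij; apply: (subvP (addvSr _ _)); apply: memv_span.
by apply/mapP; exists (i, j) => //; rewrite mem_enum inE /= nij.
Qed.

Lemma sub_weight_sum s P : (s <= weight_sum s P)%VS.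
Proof. exact: addvSl. Qed.

End Coordinates.

Section Roots.

Variables (F : fieldType) (n : nat).
Hypothesis charF : [pchar F] =i pred0.
Implicit Types (A B : 'M[F]_n) (i j k l : 'I_n).

Let natr_eq0 m : (m%:R == 0 :> F) = (m == 0)%N.
Proof. exact: (pcharf0P F).1. Qed.

Definition diag_diff i j (h : subvs_of (cartan F n)) : F^o :=
  vsval h i i - vsval h j j.

Lemma diag_diff_is_linear i j : linear (diag_diff i j).
Proof.
by move=> a u v; rewrite /diag_diff linearP !mxE /= scalerBr opprD addrACA.
Qed.

HB.instance Definition _ i j :=
  GRing.isLinear.Build F (subvs_of (cartan F n)) F^o _ (diag_diff i j)
    (diag_diff_is_linear i j).

Definition root_weight i j : weight F n := linfun (diag_diff i j).

Lemma root_weightE i j h : root_weight i j h = vsval h i i - vsval h j j.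
Proof. exact: (lfunE (diag_diff i j)). Qed.

Lemma cartan_weight A i j : A \in cartan F n ->
  root_weight i j (vsproj _ A) = A i i - A j j.
Proof. by move=> Ah; rewrite root_weightE vsprojK. Qed.

(** A traceless diagonal matrix on which the weight of [E_ij] takes the value [n] times
    [(i == k) - (j == k)]; the probes thus separate the roots. *)
Definition probe k : 'M[F]_n := n%:R *: delta_mx k k - 1%:M.

Lemma probe_cartan k : probe k \in cartan F n.
Proof.
rewrite mem_cartan; apply/andP; split.
  apply/is_diag_mxP => i j nij; rewrite !mxE (negPf (_ : i != j)) // subr0.
  case: andP => [[/eqP ek /eqP e] | _]; last by rewrite mulr0.
  by rewrite ek e eqxx in nij.
apply/eqP; rewrite linearB linearZ /= mxtrace1 /mxtrace (bigD1 k) //= big1.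
  by rewrite mxE !eqxx addr0 mulr1 subrr.
by move=> i nik; rewrite mxE (negPf nik).
Qed.

Lemma probeE k i j : probe k i i - probe k j j =
  n%:R * ((i == k)%:R - (j == k)%:R).
Proof.
by rewrite !mxE !eqxx !andbb opprB addrA subrK mulrBr.
Qed.

(** Evaluate on the probes at [i] and at [j]. Characteristic 0 allows division by [n] and excludes
    the opposite root, which would need [1 = -1]. *)
Lemma root_weight_inj i j k l : i != j ->
  (forall A, A \in cartan F n -> A k k - A l l = A i i - A j j) ->
  k = i /\ l = j.
Proof.
move=> nij eqA.
have n0 : n%:R != 0 :> F by rewrite natr_eq0 -lt0n (leq_ltn_trans _ (ltn_ord
  i)).
have sep p : (k == p)%:R - (l == p)%:R = (i == p)%:R - (j == p)%:R :> F.
  by apply: (mulfI n0); rewrite -!probeE; apply/eqA/probe_cartan.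
have two : 1 + 1 != 0 :> F by rewrite -[1 + 1]/(2%:R) natr_eq0.
split; [have := sep i | have := sep j];
  rewrite eqxx ?[j == i]eq_sym (negPf nij).
  case: eqVneq => // _; rewrite subr0 sub0r; case: eqP => _.
    by move/eqP; rewrite eq_sym -subr_eq0 opprK (negPf two).
  by move/eqP; rewrite eq_sym oppr0 oner_eq0.
rewrite sub0r; have [// | _] := eqVneq l j; rewrite subr0; case: eqP => _.
  by move/eqP; rewrite -subr_eq0 opprK (negPf two).
by move/eqP; rewrite eq_sym oppr_eq0 oner_eq0.
Qed.

Lemma bracket_cartan A B k l : A \in cartan F n ->
  lie_bracket A B k l = (A k k - A l l) * B k l.
Proof.
move=> Ah; rewrite !mxE (bigD1 k) //= [X in _ + X - _]big1 => [|i nik];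
  last first.
  by rewrite (cartan_diag Ah) ?mul0r // eq_sym.
rewrite (bigD1 l) //= [X in _ - (_ + X)]big1 => [|i nil]; last first.
  by rewrite (cartan_diag Ah) ?mulr0.
by rewrite !addr0 mulrBl [B k l * _]mulrC.
Qed.

Lemma root_space_entry (a : weight F n) A k l (h : subvs_of (cartan F n)) :
  A \in root_space a -> A k l != 0 -> a h = root_weight k l h.
Proof.
case/root_spaceP => _ /(_ h) /matrixP/(_ k l) + nA.
rewrite bracket_cartan ?subvsP // mxE root_weightE => e.
by apply: (mulIf nA); rewrite e.
Qed.

Lemma root_space_weight i j : i != j ->
  root_space (root_weight i j) = <[delta_mx i j]>%VS.
Proof.
move=> nij; apply/vspaceP => A; apply/idP/vlineP => [Ar | [c ->]].
  exists (A i j); apply/matrixP => k l; rewrite !mxE.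
  have [A0 | nA] := eqVneq (A k l) 0.
    by rewrite A0; case: andP => [[/eqP <- /eqP <-] | _];
      rewrite ?A0 ?mul0r ?mulr0.
  have [|-> ->] := @root_weight_inj i j k l nij; last by rewrite !eqxx mulr1.
  by move=> B Bh; rewrite -!cartan_weight // (root_space_entry _ Ar nA).
apply: memvZ; apply/root_spaceP; split=> [|h]; first exact: delta_offdiag_sl.
apply/matrixP => k l; rewrite bracket_cartan ?subvsP // root_weightE !mxE.
by case: andP => [[/eqP-> /eqP->] | _] //; rewrite !mulr0.
Qed.

Lemma root_weight_neq0 i j : i != j -> root_weight i j != 0.
Proof.
move=> nij; apply/eqP => w0.
have [|e _] := @root_weight_inj i j j i nij; last by rewrite e eqxx in nij.
move=> A Ah; rewrite -!cartan_weight // w0 zero_lfunE.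
have := cartan_weight i j Ah; rewrite w0 zero_lfunE => e.
by rewrite cartan_weight // -opprB -e oppr0.
Qed.

Lemma is_root_weight i j : i != j -> is_root (root_weight i j).
Proof.
move=> nij; rewrite /is_root root_weight_neq0 //= root_space_weight //.
apply/eqP => d0; have := memv_line (delta_mx i j : 'M[F]_n).
rewrite d0 memv0 => /eqP/matrixP/(_ i j); rewrite !mxE !eqxx => /eqP.
by rewrite oner_eq0.
Qed.

(** A nonzero root vector has a nonzero entry [(k, l)], on which the diagonal matrices act by
    [h_kk - h_ll]; as [a] is nonzero, [k] and [l] differ. *)
Lemma is_rootP a : is_root a -> exists i j, i != j /\ a = root_weight i j.
Proof.
case/andP=> a0 ra; set A := vpick (root_space a).
have Ar : A \in root_space a by exact: memv_pick.
have : A != 0 by rewrite vpick0.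
case/matrix0Pn => k [l nA].
have ea : a = root_weight k l.
  by apply/lfunP => h; apply: root_space_entry Ar nA.
exists k, l; split=> //; apply: contraNneq a0 => ekl.
by apply/eqP/lfunP => h; rewrite ea ekl root_weightE zero_lfunE subrr.
Qed.

End Roots.

(** * From regular decompositions to colourings *)

Section DirectSums.

Variables (F : fieldType) (vT : vectType F) (I : finType).
Variable U : I -> {vspace vT}.
Hypothesis dxU : directv (\sum_i U i)%VS.

Lemma directv_sum_mem (v : vT) i j : v \in U i -> v \in U j -> v != 0 -> i = j.
Proof.
move=> vi vj; apply: contraNeq => nij; rewrite -memv0.
rewrite -(directv_sumP dxU i isT) memv_cap vi.
by apply: subvP vj; apply: (sumv_sup j) => //; rewrite eq_sym.
Qed.

Definition summand_proj i : 'End(vT) :=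
  sumv_pi_for (erefl (\sum_j U j)%VS) i.

Lemma memv_summand_proj i v : summand_proj i v \in U i.
Proof. exact: memv_sum_pi. Qed.

Lemma summand_proj_sum v : v \in (\sum_j U j)%VS ->
  \sum_i summand_proj i v = v.
Proof. exact: sumv_pi_sum. Qed.

Lemma summand_projE i j v : v \in U j -> summand_proj i v = v *+ (i == j).
Proof.
move=> vj; have vS : v \in (\sum_j U j)%VS by apply: subvP vj; apply: sumv_sup.
have := directv_sum_unique dxU
  (fun i => summand_proj i v) (fun i => v *+ (i == j)).
rewrite summand_proj_sum // [X in v == X](bigD1 j) //= eqxx.
rewrite [X in v == _ + X]big1 => [|l /negPf -> //].
rewrite addr0 eqxx => /(_ _ _)/esym/forallP/(_ i)/eqP; apply=> l _.
  exact: memv_summand_proj.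
by case: eqP => [-> // | _]; rewrite mem0v.
Qed.

End DirectSums.

Section Data.

Variables (F : fieldType) (n m : nat).
Implicit Types (s : 'I_m -> {vspace 'M[F]_n}) (c : 'I_n -> 'I_n -> 'I_m).

Lemma bracket_delta (i j k : 'I_n) : i != k ->
  lie_bracket (delta_mx i j) (delta_mx j k) = delta_mx i k :> 'M[F]_n.
Proof.
by move=> nik; rewrite /lie_bracket mul_delta_mx mul_delta_mx_0 ?subr0 1?eq_sym.
Qed.

Definition coroot (i j : 'I_n) : 'M[F]_n := delta_mx i i - delta_mx j j.

Lemma bracket_coroot (i j : 'I_n) :
  lie_bracket (delta_mx i j) (delta_mx j i) = coroot i j.
Proof. by rewrite /lie_bracket !mul_delta_mx. Qed.

Lemma delta_mx_neq0 (i j : 'I_n) : delta_mx i j != 0 :> 'M[F]_n.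
Proof. by apply/matrix0Pn; exists i, j; rewrite mxE !eqxx oner_eq0. Qed.

(** The Cartan side of a regular decomposition; the last condition comes from [[E_ij, E_ji] = e_i -
    e_j]. *)
Definition coloured s c :=
  [/\ forall l, (s l <= cartan F n)%VS,
      directv (\sum_l s l)%VS,
      (\sum_l s l)%VS = cartan F n &
      forall i j, i != j -> coroot i j \in (s (c i j) + s (c j i))%VS].

Lemma coroot_cartan i j : coroot i j \in cartan F n.
Proof.
rewrite mem_cartan; apply/andP; split.
  apply/is_diag_mxP => k l nkl; rewrite !mxE.
  by do 2 (case: andP => [[/eqP ek /eqP el]|_];
    first by rewrite ek el eqxx in nkl);
    rewrite subrr.
have tr k : \tr (delta_mx k k : 'M[F]_n) = 1.
  rewrite /mxtrace (bigD1 k) //= big1 => [|l /negPf nl]; rewrite mxE ?nl //.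
  by rewrite !eqxx addr0.
by rewrite linearB /= !tr subrr.
Qed.

Lemma coroot_cases s c i j : coloured s c -> i != j ->
  exists2 u, u \in s (c i j) & exists2 v, v \in s (c j i) & coroot i j = u + v.
Proof. by case=> _ _ _ cor nij; apply/memv_addP/cor. Qed.

End Data.

Section Regular.

Variables (F : fieldType) (n m k : nat) (g : 'I_m -> {vspace 'M[F]_n}).
Hypothesis charF : [pchar F] =i pred0.

Lemma regular_form_weight_sum (s : {vspace 'M[F]_n}) D V : regular_form s D V ->
  V = weight_sum s (fun i j => root_weight F i j \in D).
Proof.
case=> sh [_ /allP rD] _ ->; congr (_ + _)%VS; apply/eqP; rewrite eqEsubv.
apply/andP; split.
  rewrite big_seq; elim/big_ind: _ => [|U W UV WV | a aD]; first exact: sub0v.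
    by rewrite subv_add UV WV.
  have [i [j [nij ea]]] := is_rootP (rD a aD).
  rewrite {1}ea root_space_weight //; apply: memv_span; apply/mapP.
  by exists (i, j) => //; rewrite mem_enum inE /= nij -ea.
apply/span_subvP => _ /mapP[[i j] + ->];
  rewrite mem_enum inE /= => /andP[nij aD].
rewrite (big_rem _ aD) /=; apply: (subvP (addvSl _ _)).
by rewrite root_space_weight // memv_line.
Qed.

Lemma regular_coloured : regular_decomposition k g ->
  exists (s : 'I_m -> {vspace 'M[F]_n}) (c : 'I_n -> 'I_n -> 'I_m),
    [/\ coloured s c, closed_colouring c,
        forall l, g l = weight_sum (s l) (fun i j => c i j == l) &
        #|[set l | s l != 0%VS]| = k].
Proof.
case=> m2 [dxg sumg] g0 [subg subgg] [s [D [form cardk]]].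
have sh l : (s l <= cartan F n)%VS by case: (form l).
have gD l := regular_form_weight_sum (form l).
(* The default is never taken for [i != j]: if no summand had this root, entry [(i, j)] would vanish
   on all of sl. *)
pose c i j := odflt (Ordinal (ltnW m2)) [pick l | root_weight F i j \in D l].
have cP i j : i != j -> root_weight F i j \in D (c i j).
  move=> nij; rewrite /c; case: pickP => //= none.
  have := delta_offdiag_sl F nij; rewrite -sumg => /memv_sumP[x gx].
  move/matrixP/(_ i j); rewrite summxE mxE !eqxx big1 => [/eqP|l _].
    by rewrite oner_eq0.
  have := gx l isT; rewrite gD => /mem_weight_sum -/(_ (sh l)) [_ ->] //.
  by rewrite none.
have gc l : g l = weight_sum (s l) (fun i j => c i j == l).
  rewrite gD; apply: eq_weight_sum => i j nij.
  apply/idP/eqP => [aD | <-]; last exact: cP.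
  apply: (directv_sum_mem dxg (v := delta_mx i j)); last exact: delta_mx_neq0.
    by rewrite gD weight_sum_delta ?cP.
  by rewrite gD weight_sum_delta.
have dg i j : i != j -> delta_mx i j \in g (c i j).
  by move=> nij; rewrite gc weight_sum_delta.
have br x y a b : x \in g a -> y \in g b -> lie_bracket x y \in (g a + g b)%VS.
  have [-> | nab] := eqVneq a b; first by rewrite addvv; case: (subg b) => _;
    apply.
  case: (subgg a b nab) => _ clab xa yb; apply: clab.
    exact: (subvP (addvSl _ _)).
  exact: (subvP (addvSr _ _)).
exists s, c; split=> //; last first.
  move=> i j l /eqP nij /eqP njl /eqP nil.
  (* Compare entries [(i, l)]: that of [E_il] is 1, while a summand of another colour than [c i l]
     is zero there. *)
  have := br _ _ _ _ (dg i j nij) (dg j l njl).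
  rewrite bracket_delta // => /memv_addP[u ua [v vb euv]].
  have [e | /negPf n1] := eqVneq (c i l) (c i j); first by left.
  have [e | /negPf n2] := eqVneq (c i l) (c j l); first by right.
  move: ua vb; rewrite !gc => /mem_weight_sum -/(_ (sh _)) [_ u0].
  move=> /mem_weight_sum -/(_ (sh _)) [_ v0]; move/matrixP/(_ i l): euv.
  rewrite !mxE !eqxx u0 ?n1 // v0 ?n2 // addr0 => /eqP.
  by rewrite oner_eq0.
have dgs l x : x \in g l -> diag_part x \in s l.
  by rewrite gc => /mem_weight_sum -/(_ (sh l)) [].
split=> //.
- apply/directv_sum_independent => x xs;
  apply: (directv_sum_independent dxg) => l _.
  by rewrite gc; apply: (subvP (sub_weight_sum _ _)); apply: xs.
- apply/eqP; rewrite eqEsubv; apply/andP; split; first exact/subv_sumP.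
  apply/subvP => h hh; have := subvP (cartan_sl F n) h hh.
  rewrite -sumg => /memv_sumP[x gx eh];
    rewrite -(diag_part_id hh) eh linear_sum.
  by apply: memv_sumr => l _; apply/dgs/gx.
move=> i j nij; have nji : j != i by rewrite eq_sym.
have := br _ _ _ _ (dg i j nij) (dg j i nji); rewrite bracket_coroot.
move=> /memv_addP[u ua [v vb euv]].
rewrite -(diag_part_id (coroot_cartan _ i j)) euv linearD.
by apply: memv_add; apply: dgs.
Qed.

End Regular.

(** * Row colourings *)

Section Rows.

Variables (F : fieldType) (n m : nat).
Implicit Types (W : 'M[F]_n.+1) (r : 'I_n.+1 -> 'I_m) (A : pred 'I_m).
Implicit Types (s : 'I_m -> {vspace 'M[F]_n.+1}).
Implicit Types (c : 'I_n.+1 -> 'I_n.+1 -> 'I_m) (l : 'I_m) (i j : 'I_n.+1).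

Definition unit_diff W i : 'M[F]_n.+1 := delta_mx i i - W.

(** [A] is a set of colours, so that a single summand ([pred1 l]) and a sum of two summands have the
    same shape. *)
Definition row_cartan r W A : {vspace 'M[F]_n.+1} :=
  (\sum_(i | A (r i)) <[unit_diff W i]>)%VS.

Lemma mem_row_cartan r W A (x : 'M[F]_n.+1) :
  reflect (exists b : 'I_n.+1 -> F, x = \sum_(i | A (r i)) b i *: unit_diff W i)
          (x \in row_cartan r W A).
Proof.
apply: (iffP memv_sumP) => [[y yU ->] | [b ->]].
  have [b yE] : exists b : 'I_n.+1 -> F,
      forall i, A (r i) -> y i = b i *: unit_diff W i.
    apply: (@fin_all_exists _ (fun=> F) (fun i a => A (r i) -> y i = a *:
      _)) => i.
    case: (boolP (A (r i))) => [/yU/vlineP[a ya] | _]; last by exists 0.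
    by exists a.
  by exists b; apply: eq_bigr.
by exists (fun i => b i *: unit_diff W i) => // i _; apply/memvZ/memv_line.
Qed.

Lemma unit_diff_row_cartan r W A i :
  A (r i) -> unit_diff W i \in row_cartan r W A.
Proof. by move=> Ai; rewrite memvE; apply: (sumv_sup i). Qed.

(** Any [W] is allowed, because its total coefficient is the trace of [h]. *)
Lemma cartan_sum W (h : 'M[F]_n.+1) : h \in cartan F n.+1 ->
  h = \sum_i h i i *: unit_diff W i.
Proof.
move=> hh; under eq_bigr do rewrite scalerBr.
rewrite big_split sumrN /= -scaler_suml -/(mxtrace h) (trace_cartan hh).
rewrite scale0r subr0 {1}[h]matrix_sum_delta; apply: eq_bigr => i _.
rewrite (bigD1 i) //= big1 ?addr0 // => j nji.
by rewrite (cartan_diag hh) ?scale0r // eq_sym.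
Qed.

(** If no root had colour [l], the projection to [s l] would kill all coroots, which span the Cartan
    subalgebra; then the summand would have neither Cartan part nor roots. *)
Lemma coloured_used s c l : coloured s c ->
  weight_sum (s l) (fun i j => c i j == l) != 0%VS ->
  exists i j, i <> j /\ c i j = l.
Proof.
case=> sh dxs sums cor; rewrite -vpick0; set x := vpick _ => x0.
have [/existsP[i /existsP[j /andP[/eqP nij /eqP cij]]] | none] :=
    boolP [exists i, exists j, (i != j) && (c i j == l)]; first by exists i, j.
have nc i j : i != j -> c i j == l = false.
  move=> nij; apply: contraNF none => cij.
  by apply/existsP; exists i; apply/existsP; exists j; rewrite nij.
have sl0 h : h \in s l -> h = 0.
  move=> hs; have hh := subvP (sh l) h hs.
  have pc i : summand_proj s l (unit_diff (delta_mx 0 0) i) = 0.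
    have [-> | ni0] := eqVneq i 0; first by rewrite /unit_diff subrr linear0.
    have [u uc [v vc euv]] := coroot_cases (And4 sh dxs sums cor) ni0.
    rewrite -[unit_diff _ _]/(coroot F i 0) euv linearD /=.
    rewrite (summand_projE dxs l uc) (summand_projE dxs l vc).
    by rewrite ![l == _]eq_sym !nc ?addr0 // eq_sym.
  have := summand_projE dxs l hs; rewrite eqxx mulr1n => <-.
  rewrite (cartan_sum (delta_mx 0 0) hh) linear_sum big1 // => i _.
  by rewrite linearZ /= pc scaler0.
case/eqP: x0; have := memv_pick (weight_sum (s l) (fun i j => c i j == l)).
rewrite -/x => /mem_weight_sum -/(_ (sh l)) [/sl0 dx x0].
apply/matrixP => i j; rewrite mxE; have [-> | nij] := eqVneq i j.
  by move/matrixP/(_ j j): dx; rewrite diag_partE eqxx mxE.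
by rewrite x0 ?nc.
Qed.

Definition row_datum r W l0 :=
  [/\ is_diag_mx W, \tr W = 1, forall i, r i != l0 -> W i i = 0 &
      forall l, exists i, r i = l].

(* u_i is the part of e_i - e_q in s_(r i), for any q of another colour. *)
Lemma row_coloured_units s c r : coloured s c ->
  (forall i j, i <> j -> c i j = r i) -> (forall l, exists i, r i = l) ->
  (1 < m)%N ->
  exists W, (forall i, unit_diff W i \in s (r i)) /\
    forall l, s l = row_cartan r W (pred1 l).
Proof.
move=> col rc surj m1; have [sh dxs sums cor] := col.
have [q qP] : exists q : 'I_m -> 'I_n.+1, forall l, r (q l) != l.
  apply: (@fin_all_exists _ (fun=> 'I_n.+1) (fun l i => r i != l)) => l.
  have /existsP[l' nl] : [exists l', l' != l].
    apply: contraLR m1 => /existsPn alll; rewrite -leqNgt -(card_ord m).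
    apply/card_le1_eqP => a b _ _.
    by have := alll a; have := alll b; rewrite !negbK => /eqP-> /eqP->.
  by have [i ri] := surj l'; exists i; rewrite ri.
pose pr := summand_proj s.
have pr0 l i j : l != r i -> l != r j -> pr l (coroot F i j) = 0.
  move=> ni nj; have [-> | nij] := eqVneq i j;
    first by rewrite /coroot subrr linear0.
  have [u uc [v vc ->]] := coroot_cases col nij.
  rewrite linearD /= /pr (summand_projE dxs l uc) (summand_projE dxs l vc).
  rewrite !rc ?(negPf ni) ?(negPf nj) ?addr0 //; apply/eqP => //.
  by rewrite eq_sym.
pose u i := pr (r i) (coroot F i (q (r i))).
have us i : u i \in s (r i) by apply: memv_summand_proj.
(* For [l != r i] neither [i] nor [q l] has colour [l], so the projection vanishes. *)
have prq l i : pr l (coroot F i (q l)) = u i *+ (l == r i).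
  have [-> // | nl] := eqVneq l (r i).
  by rewrite pr0 // eq_sym.
(* Write [e_i - e_j] as [(e_i - e_(q l)) - (e_j - e_(q l))], project to each colour [l] and add
   up. *)
have uE i j : coroot F i j = u i - u j.
  have cs : coroot F i j \in (\sum_l s l)%VS by rewrite sums coroot_cartan.
  rewrite -(summand_proj_sum cs).
  transitivity (\sum_l (u i *+ (l == r i) - u j *+ (l == r j))).
    apply: eq_bigr => l _; rewrite -!prq -raddfB; congr (pr l _).
    by rewrite /coroot opprB addrA subrK.
  rewrite sumrB (bigD1 (r i)) //= [X in _ - X](bigD1 (r j)) //= !eqxx.
  by rewrite !big1 ?addr0 // => l /negPf ->.
(* By [uE] the matrix [e_i - u_i] is the same for all [i]; [W] is this common value. *)
pose W := delta_mx 0 0 - u 0.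
have uW i : u i = unit_diff W i.
  by have := uE i 0; rewrite /unit_diff /W opprB addrA [_ + u 0]addrC -addrA
    -/(coroot F i 0) => ->; rewrite addrC subrK.
exists W; split=> [i|l]; first by rewrite -uW.
apply/eqP; rewrite eqEsubv; apply/andP; split; last first.
  by apply/subv_sumP => i /eqP <-; rewrite -memvE -uW.
apply/subvP => x xs; have xh := subvP (sh l) x xs.
have := summand_projE dxs l xs; rewrite eqxx mulr1n => <-.
rewrite (cartan_sum W xh) linear_sum; apply: memv_suml => i _.
rewrite linearZ -uW /= (summand_projE dxs l (us i)).
have [e | _] := eqVneq l (r i); last by rewrite scaler0 mem0v.
by rewrite uW; apply/memvZ/unit_diff_row_cartan; rewrite /= e.
Qed.

(* The relation sum_i W_ii (e_i - W) = 0 splits along the direct sum, so W is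
   proportional to the part of W lying in one colour. *)
Lemma row_coloured s c r : coloured s c ->
  (forall i j, i <> j -> c i j = r i) -> (forall l, exists i, r i = l) ->
  (1 < m)%N ->
  exists W l0, row_datum r W l0 /\ forall l, s l = row_cartan r W (pred1 l).
Proof.
move=> col rc surj m1; have [W [uW sW]] := row_coloured_units col rc surj m1.
have [sh dxs sums _] := col; exists W.
have uh i : unit_diff W i \in cartan F n.+1 by apply: (subvP (sh (r i))).
have trW : \tr W = 1.
  have := trace_cartan (uh 0); rewrite linearB /= => /eqP.
  rewrite subr_eq0 => /eqP <-.
  rewrite /mxtrace (bigD1 0) //= big1 => [|l /negPf nl]; rewrite mxE ?nl //.
  by rewrite !eqxx addr0.
have dW i j : i != j -> W i j = 0.
  move=> nij; have := cartan_diag (uh i) nij; rewrite !mxE eqxx /=.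
  by rewrite eq_sym (negPf nij) sub0r => /eqP; rewrite oppr_eq0 => /eqP.
have WE : W = \sum_i W i i *: delta_mx i i.
  rewrite {1}[W]matrix_sum_delta; apply: eq_bigr => i _.
  rewrite (bigD1 i) //= big1 ?addr0 // => j nji.
  by rewrite dW ?scale0r // eq_sym.
pose x l := \sum_(i | r i == l) W i i *: unit_diff W i.
have x0 l : x l = 0.
  apply: (directv_sum_independent dxs) => // [{}l _|].
    by apply: memv_suml => i /eqP <-; apply: memvZ.
  transitivity (\sum_i W i i *: unit_diff W i).
    by rewrite [RHS](partition_big r xpredT).
  under eq_bigr do rewrite scalerBr.
  by rewrite big_split sumrN /= -WE -scaler_suml -/(mxtrace W) trW scale1r
    subrr.
(* The trace 1 of [W] is the sum of its partial traces over the colours, so one of these is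
   nonzero. *)
have [l0 tl0] : exists l0, \sum_(i | r i == l0) W i i != 0.
  apply/existsP; apply: contraTT isT => /existsPn t0.
  have : \tr W = 0.
    rewrite /mxtrace (partition_big r xpredT) //= big1 // => l _.
    by apply/eqP; have := t0 l; rewrite negbK.
  by rewrite trW => /eqP; rewrite oner_eq0.
exists l0; split=> //; split=> //; first by apply/is_diag_mxP.
(* With [t] the partial trace over [l0], the relation of colour [l0] says that [t W] is the part of
   [W] on these rows; an entry in another row gives [t W_ii = 0]. *)
move=> i nri; have := x0 l0; rewrite /x; under eq_bigr do rewrite scalerBr.
rewrite big_split sumrN /= -scaler_suml => /matrixP/(_ i i).
rewrite !mxE summxE big1 => [/eqP|j /eqP rj].
  by rewrite sub0r oppr_eq0 mulf_eq0 (negPf tl0) => /eqP.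
rewrite !mxE; case: eqP => [e | _]; last by rewrite mulr0.
by rewrite e rj eqxx in nri.
Qed.

End Rows.

Lemma free_delta_mx (F : fieldType) n (ps : seq ('I_n * 'I_n)) :
  uniq ps -> free [seq delta_mx p.1 p.2 : 'M[F]_n | p <- ps].
Proof.
elim: ps => [|p ps IH] /=; first by rewrite nil_free.
case/andP=> np /IH fps; rewrite free_cons fps andbT.
pose Q i j := (i, j) == p.
have XQ : (<<[seq delta_mx q.1 q.2 : 'M[F]_n | q <- ps]>>
             <= lker (linfun (@entry_mask F n Q)))%VS.
  apply/span_subvP => _ /mapP[q qs ->]; rewrite memv_ker lfunE.
  apply/eqP/matrixP => i j; rewrite !mxE.
  case: andP => [[/eqP-> /eqP->]|_]; last by rewrite mul0rn.
  rewrite /Q -surjective_pairing; case: eqP => // eqp.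
  by rewrite -eqp qs in np.
apply/negP => /(subvP XQ); rewrite memv_ker lfunE => /eqP/matrixP/(_ p.1 p.2).
by rewrite !mxE /Q -surjective_pairing !eqxx /= => /eqP; rewrite oner_eq0.
Qed.

(** * Regular form of sums of root lines *)

Section RootSums.

Variables (F : fieldType) (n : nat) (P : rel 'I_n).
Hypothesis charF : [pchar F] =i pred0.

Let pairs := enum [pred p : 'I_n * 'I_n | (p.1 != p.2) && P p.1 p.2].

Let deltas : seq 'M[F]_n := [seq delta_mx p.1 p.2 | p <- pairs].

Definition roots_of : seq (weight F n) := [seq root_weight F p.1 p.2 | p <-
  pairs].

Lemma roots_of_roots : uniq roots_of /\ all (@is_root F n) roots_of.
Proof.
split; last first.
  apply/allP => _ /mapP[[i j] + ->]; rewrite mem_enum inE /= => /andP[nij _].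
  exact: is_root_weight.
rewrite map_inj_in_uniq ?enum_uniq // => -[k l] [i j] _.
rewrite mem_enum inE /= => /andP[nij _] e.
have [|-> -> //] := @root_weight_inj _ _ charF i j k l nij.
by move=> A Ah; rewrite -!cartan_weight // e.
Qed.

(** Directness of the root part is a dimension count, each root space being a line through one of
    the free matrices [E_ij]; the diagonal part separates it from [s]. *)
Lemma roots_of_regular (s : {vspace 'M[F]_n}) : (s <= cartan F n)%VS ->
  regular_form s roots_of (weight_sum s P).
Proof.
move=> sh; have [uD rD] := roots_of_roots.
have sumE : (\sum_(a <- roots_of) root_space a)%VS = <<deltas>>%VS.
  rewrite span_def !big_map; apply: eq_big_seq => -[i j].
  by rewrite mem_enum inE /= => /andP[nij _]; rewrite root_space_weight.
split=> //; last by rewrite sumE.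
rewrite directv_addE directv_trivial /=; apply/andP; split; last first.
  rewrite sumE -subv0; apply/subvP => A /memv_capP[As Ad].
  have : A \in weight_sum 0 P by rewrite /weight_sum add0v.
  case/mem_weight_sum => [|+ _]; first exact: sub0v.
  by rewrite (diag_part_id (subvP sh _ As)).
rewrite directvE /= sumE.
have /eqP -> := free_delta_mx F (enum_uniq _ : uniq pairs).
rewrite big_map size_map -sum1_size; apply/eqP; rewrite !big_seq.
apply: eq_bigr => -[i j]; rewrite mem_enum inE /= => /andP[nij _].
by rewrite root_space_weight // dim_vline delta_mx_neq0.
Qed.

End RootSums.

(** * Cartan parts defined by a row datum *)

Section RowDatum.

Variables (F : fieldType) (n m : nat).
Variables (r : 'I_n.+1 -> 'I_m) (W : 'M[F]_n.+1) (l0 : 'I_m).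
Hypothesis rW : row_datum r W l0.
Implicit Types (A : pred 'I_m) (l : 'I_m) (i j : 'I_n.+1) (x y : 'M[F]_n.+1).

Lemma datum_off i j : i != j -> W i j = 0.
Proof. by case: rW => /is_diag_mxP dW _ _ _; apply: dW. Qed.

Lemma unit_diff_cartan i : unit_diff W i \in cartan F n.+1.
Proof.
have [dW trW _ _] := rW; rewrite mem_cartan; apply/andP; split.
  apply/is_diag_mxP => k l nkl; rewrite !mxE (is_diag_mxP dW) // subr0.
  by case: andP => // -[/eqP ek /eqP el]; rewrite ek el eqxx in nkl.
rewrite linearB /= trW /mxtrace (bigD1 i) //= big1 => [|k /negPf nk].
  by rewrite mxE !eqxx addr0 subrr.
by rewrite mxE nk.
Qed.

Lemma row_cartan_sub A : (row_cartan r W A <= cartan F n.+1)%VS.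
Proof. by apply/subv_sumP => i _; rewrite -memvE unit_diff_cartan. Qed.

Lemma row_cartan_entry A (b : 'I_n.+1 -> F) i :
  (\sum_(j | A (r j)) b j *: unit_diff W j) i i =
  b i *+ A (r i) - (\sum_(j | A (r j)) b j) * W i i.
Proof.
rewrite summxE; under eq_bigr do rewrite !mxE mulrBr.
rewrite sumrB -mulr_suml; congr (_ - _).
have [Ai | nAi] := boolP (A (r i)).
  rewrite (bigD1 i) //= !eqxx mulr1 big1 ?addr0 // => j /andP[_ nji].
  by rewrite eq_sym (negPf nji) mulr0.
apply: big1 => j Aj; rewrite (_ : i == j = false) ?mulr0 //.
by apply: contraNF nAi => /eqP ->.
Qed.

Lemma cartan_row_cartan A x : x \in cartan F n.+1 ->
  (forall i, ~~ A (r i) -> x i i = 0) -> x \in row_cartan r W A.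
Proof.
move=> xh x0; apply/mem_row_cartan; exists (fun i => x i i).
rewrite {1}(cartan_sum W xh) (bigID (fun i => A (r i))) /=.
by rewrite [X in _ + X]big1 ?addr0 // => i /x0 ->; rewrite scale0r.
Qed.



(** In a row of colour other than [l0] the matrix [W] has diagonal entry 0, so that entry of the
    total relation is the coefficient itself. Hence all components except that of [l0] vanish, and
    the last one follows from the sum. *)
Lemma row_cartan_independent (x : 'I_m -> 'M[F]_n.+1) :
  (forall l, x l \in row_cartan r W (pred1 l)) -> \sum_l x l = 0 ->
  forall l, x l = 0.
Proof.
move=> xP x0.
have [b bP] : exists b : 'I_m -> 'I_n.+1 -> F, forall l,
    x l = \sum_(i | pred1 l (r i)) b l i *: unit_diff W i.
  apply: (@fin_all_exists _ (fun=> 'I_n.+1 -> F)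
    (fun l b => x l = \sum_(i | pred1 l (r i)) b i *: unit_diff W i)) => l.
  exact/mem_row_cartan/xP.
pose d i := b (r i) i.
have xE l : x l = \sum_(i | r i == l) d i *: unit_diff W i.
  by rewrite bP; apply: eq_bigr => i /eqP <-.
have sumd : \sum_i d i *: unit_diff W i = 0.
  rewrite -[RHS]x0 [LHS](partition_big r xpredT) //=.
  by apply: eq_bigr => l _; rewrite xE.
have [_ _ W0 _] := rW.
have d0 i : r i != l0 -> d i = 0.
  move=> /W0 Wi; have := row_cartan_entry predT d i.
  by rewrite sumd Wi mulr0 subr0 mxE.
have xl l : l != l0 -> x l = 0.
  move=> nl; rewrite xE big1 // => i /eqP ri.
  by rewrite d0 ?scale0r // ri.
move=> l; have [-> | /xl //] := eqVneq l l0.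
by move: x0; rewrite (bigD1 l0) //= big1 ?addr0.
Qed.

Lemma row_cartan_sum : (\sum_l row_cartan r W (pred1 l))%VS = cartan F n.+1.
Proof.
apply/eqP; rewrite eqEsubv; apply/andP; split.
  by apply/subv_sumP => l _; apply: row_cartan_sub.
apply/subvP => x /(cartan_sum W) ->; apply: memv_suml => i _.
apply: memvZ; apply: (subvP (sumv_sup (r i) _ (subvv _))) => //.
by apply: unit_diff_row_cartan => /=.
Qed.

Lemma row_cartan_neq0 l : l != l0 -> row_cartan r W (pred1 l) != 0%VS.
Proof.
have [_ _ W0 surj] := rW; have [i ri] := surj l => nl.
apply/eqP => s0; have : unit_diff W i \in row_cartan r W (pred1 l).
  by apply: unit_diff_row_cartan; rewrite /= ri.
rewrite s0 memv0 => /eqP/matrixP/(_ i i); rewrite !mxE !eqxx W0 ?ri //.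
by rewrite subr0 => /eqP; rewrite oner_eq0.
Qed.

(** Two rows [i], [j] of colour [l0] contribute [e_i - e_j]; with a single row [i0] the trace
    condition forces [W = e_i0], and the only generator vanishes. *)
Lemma row_cartan_l0_neq0 :
  (row_cartan r W (pred1 l0) != 0%VS) = (1 < #|[pred i | r i == l0]|)%N.
Proof.
have [dW trW W0 surj] := rW; have [i0 ri0] := surj l0.
apply/idP/idP; last first.
  case/card_gt1P => i [j [ri rj nij]]; apply/eqP => s0.
  have : unit_diff W i - unit_diff W j \in row_cartan r W (pred1 l0).
    by apply: memvB; apply: unit_diff_row_cartan.
  rewrite s0 memv0 /unit_diff opprB addrA subrK => /eqP/matrixP/(_ i i).
  by rewrite !mxE !eqxx (negPf nij) subr0 => /eqP; rewrite oner_eq0.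
apply: contraR; rewrite -leqNgt => /card_le1_eqP one.
have r1 i : r i == l0 -> i = i0 by move=> ri; apply: one => //; rewrite inE ri0.
have Wi : W = delta_mx i0 i0.
  have Wi0 : W i0 i0 = 1.
    rewrite -trW /mxtrace (bigD1 i0) //= big1 ?addr0 // => i ni.
    by apply: W0; apply: contraNneq ni => ri; apply/eqP/r1/eqP.
  apply/matrixP => i j; rewrite mxE; have [<- | nij] := eqVneq i j; last first.
    rewrite (datum_off nij); case: andP => // -[/eqP e /eqP e'].
    by rewrite e e' eqxx in nij.
  rewrite andbb; have [-> // | ni] := eqVneq i i0.
  by apply: W0; apply: contraNneq ni => ri; apply/eqP/r1/eqP.
rewrite -subv0; apply/subv_sumP => i /r1 ->.
by rewrite /unit_diff Wi subrr.
Qed.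

Lemma card_row_cartan : #|[set l | row_cartan r W (pred1 l) != 0%VS]| =
  if (1 < #|[pred i | r i == l0]|)%N then m else m.-1.
Proof.
have [gt1 | le1] := ifPn.
  rewrite (_ : [set l | _] = setT) ?cardsT ?card_ord //.
  apply/setP => l; rewrite !inE; have [-> | /row_cartan_neq0 //] := eqVneq l l0.
  by rewrite row_cartan_l0_neq0.
rewrite (_ : [set l | _] = [set~ l0]).
  by have := cardsC1 l0; rewrite card_ord => ->.
apply/setP => l; rewrite !inE; have [-> | /row_cartan_neq0 //] := eqVneq l l0.
by rewrite row_cartan_l0_neq0 (negPf le1).
Qed.

End RowDatum.

(** * Row data give regular decompositions *)

Section RowDecomposition.

Variables (F : fieldType) (n m : nat).
Variables (r : 'I_n.+1 -> 'I_m) (W : 'M[F]_n.+1) (l0 : 'I_m).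
Hypothesis rW : row_datum r W l0.
Implicit Types (A B : pred 'I_m) (l : 'I_m) (i j : 'I_n.+1) (x y : 'M[F]_n.+1).

Definition rows A : {vspace 'M[F]_n.+1} :=
  weight_sum (row_cartan r W A) (fun i _ => A (r i)).

Let mem_rows A x := mem_weight_sum (fun i _ => A (r i)) x (row_cartan_sub rW A).

Lemma mul_rows_off x y i j : (forall k, k != i -> x i k = 0) ->
  (x *m y) i j = x i i * y i j.
Proof.
by move=> x0; rewrite mxE (bigD1 i) //= big1 ?addr0 // => k /x0 ->;
  rewrite mul0r.
Qed.

(** In a row of colour outside [A] an element has at most its diagonal entry. There the bracket has
    entries [x_ii y_ij - y_ii x_ij], which vanish both on and off the diagonal. *)
Lemma rows_lie A : lie_subalgebra (rows A).
Proof.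
split=> [|x y xA yA]; first exact/weight_sum_sl/(row_cartan_sub rW).
have offA z i : z \in rows A -> ~~ A (r i) -> forall k, k != i -> z i k = 0.
  by move=> /mem_rows[_ z0] nA k nk; rewrite z0 // eq_sym.
have brE i j : ~~ A (r i) -> lie_bracket x y i j = x i i * y i j - y i i * x i
  j.
  move=> nA; rewrite -(mul_rows_off y j (offA x i xA nA)).
  by rewrite -(mul_rows_off x j (offA y i yA nA)) /lie_bracket !mxE.
apply/mem_rows; split=> [|i j nij nA]; last first.
  have nji : j != i by rewrite eq_sym.
  by rewrite brE // (offA x i xA nA j nji) (offA y i yA nA j nji) !mulr0 subrr.
apply: cartan_row_cartan => [|i nA].
  by apply: diag_part_cartan;
    rewrite /lie_bracket linearB /= mxtrace_mulC subrr.
by rewrite diag_partE eqxx brE // mulrC subrr.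
Qed.



Lemma sub_rows A B : (forall l, A l -> B l) -> (rows A <= rows B)%VS.
Proof.
move=> AB; apply: addvS; last first.
  apply: sub_span => _ /mapP[[i j] + ->];
    rewrite mem_enum inE /= => /andP[nij Ai].
  by apply/mapP; exists (i, j) => //; rewrite mem_enum inE /= nij AB.
by apply/subv_sumP => i /AB Bi; apply: (sumv_sup i).
Qed.

Lemma delta_rows A i j : i != j -> A (r i) -> delta_mx i j \in rows A.
Proof. exact: weight_sum_delta. Qed.

Lemma row_cartan_rows A : (row_cartan r W A <= rows A)%VS.
Proof. exact: sub_weight_sum. Qed.

Lemma rows_add A B : (rows A + rows B)%VS = rows (fun l => A l || B l).
Proof.
apply/eqP; rewrite eqEsubv; apply/andP; split.
  by rewrite subv_add !sub_rows // => l ->; rewrite ?orbT.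
rewrite subv_add; apply/andP; split.
  apply/subv_sumP => i /orP[Ai|Bi]; rewrite -memvE.
    apply: (subvP (addvSl _ _)); apply: (subvP (row_cartan_rows A)).
    exact: unit_diff_row_cartan.
  apply: (subvP (addvSr _ _)); apply: (subvP (row_cartan_rows B)).
  exact: unit_diff_row_cartan.
apply/span_subvP => _ /mapP[[i j] + ->].
rewrite mem_enum inE /= => /andP[nij /orP[Ai|Bi]].
  by apply: (subvP (addvSl _ _)); apply: delta_rows.
by apply: (subvP (addvSr _ _)); apply: delta_rows.
Qed.

(** Independence is entrywise: an off-diagonal entry [(i, j)] occurs only in the summand [r i], and
    the diagonal parts are independent by [row_cartan_independent]. *)
Lemma rows_regular (g : 'I_m -> {vspace 'M[F]_n.+1}) :
  [pchar F] =i pred0 -> (0 < n)%N -> (1 < m)%N ->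
  (forall l, g l = rows (pred1 l)) ->
  regular_decomposition #|[set l | row_cartan r W (pred1 l) != 0%VS]| g.
Proof.
move=> charF n0 m1 gE.
have [_ _ _ surj] := rW.
split=> //.
- split.
    apply/directv_sum_independent => x xg x0 l _.
    have xr k : x k \in rows (pred1 k) by rewrite -gE; apply: xg.
    apply/matrixP => i j; rewrite mxE; have [<- | nij] := eqVneq i j.
      have dx k : diag_part (x k) \in row_cartan r W (pred1 k).
        by have /mem_rows[] := xr k.
      have sum0 : \sum_k diag_part (x k) = 0 by rewrite -linear_sum x0 linear0.
      have /matrixP/(_ i i) := row_cartan_independent rW dx sum0 l.
      by rewrite diag_partE eqxx mxE.
    have x0l k : k != r i -> x k i j = 0.
      move=> nk; have /mem_rows[_ -> //] := xr k.
      by rewrite /= eq_sym.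
    have [-> | /x0l //] := eqVneq l (r i).
    have /matrixP/(_ i j) := x0; rewrite summxE mxE (bigD1 (r i)) //=.
    by rewrite big1 ?addr0 // => k /x0l.
  apply/eqP; rewrite eqEsubv; apply/andP; split.
    by apply/subv_sumP => l _; rewrite gE;
      apply/weight_sum_sl/(row_cartan_sub rW).
  have gS l : (rows (pred1 l) <= \sum_k g k)%VS by rewrite -gE;
    apply: (sumv_sup l).
  apply/subvP => x; rewrite mem_sl => /eqP trx.
  rewrite -[x](subrK (diag_part x)); apply: memvD; last first.
    have := diag_part_cartan trx; rewrite -(row_cartan_sum rW); apply: subvP.
    by apply/subv_sumP => l _; apply: subv_trans (gS l); apply: row_cartan_rows.
  rewrite [x - _]matrix_sum_delta; apply: memv_suml => i _.
  apply: memv_suml => j _; rewrite !mxE; have [-> | nij] := eqVneq i j.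
    by rewrite subrr scale0r mem0v.
  by apply/memvZ/(subvP (gS (r i)))/delta_rows => /=.
- move=> l; have [i ri] := surj l; apply/eqP => g0.
  have [j nij] : exists j, i != j.
    have [-> | ni0] := eqVneq i 0; last by exists 0.
    by exists ord_max; rewrite -val_eqE /= eq_sym -lt0n.
  have : delta_mx i j \in g l by rewrite gE; apply: delta_rows => //=;
    rewrite ri.
  by rewrite g0 memv0 (negPf (delta_mx_neq0 _ _ _)).
- split=> [l | l l' _]; rewrite !gE; first exact: rows_lie.
  by rewrite rows_add; apply: rows_lie.
exists (fun l => row_cartan r W (pred1 l)).
exists (fun l => roots_of F (fun i _ => pred1 l (r i))); split=> // l.
by rewrite gE; apply: roots_of_regular => //; apply: (row_cartan_sub rW).
Qed.

End RowDecomposition.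

(** * Permutations and normal forms *)

Section Blocks.

Local Open Scope nat_scope.

(* Block 0 is [0, lam_0], one longer than lam_0 since it contains the index 0.
  *)
Fixpoint block_index (lam : seq nat) (i : nat) : nat :=
  if lam is a :: lam' then
    if i <= a then 0 else (block_index lam' (i - a)).+1
  else 0.

Lemma block_index_lt lam i : lam != [::] -> i <= sumn lam ->
  block_index lam i < size lam.
Proof.
elim: lam i => [//|a lam IH] i _ /= ile; case: (leqP i a) => // ltai.
rewrite ltnS IH ?leq_subLR //; apply: contraTneq ltai => lam0.
by rewrite -leqNgt; rewrite lam0 /= addn0 in ile.
Qed.

Lemma block_indexP lam i l : l < size lam -> i <= sumn lam ->
  (block_index lam i == l) = if l == 0 then i <= nth 0 lam 0 else block lam l i.
Proof.
elim: lam i l => [//|a lam IH] i [|l] /=; first by case: (leqP i a).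
rewrite ltnS /block /= => llam ile; case: (leqP i a) => [lia | ltai].
  by rewrite eqE /= ltnNge (leq_trans lia (leq_addr _ _)).
rewrite eqSS IH ?leq_subLR // /block.
case: l llam => [|l] /= llam.
  case: (lam) llam => //= b lam' _.
  by rewrite take0 /= !addn0 ltai.
by rewrite ltn_subRL leq_subLR.
Qed.

Lemma card_ord_interval N a b : b <= N ->
  #|[pred i : 'I_N | a <= i < b]| = b - a.
Proof.
move=> bN; rewrite -sum1_card -[RHS]muln1 -sum_nat_const_nat.
rewrite (big_nat_widen _ _ _ _ _ bN) big_geq_mkord.
by apply: eq_bigl => i; rewrite inE andbC.
Qed.

Lemma sumn_take1 lam : sumn (take 1 lam) = nth 0 lam 0.
Proof. by case: lam => //= a lam; rewrite take0 addn0. Qed.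

Lemma card_block_index lam l : l < size lam ->
  #|[pred i : 'I_(sumn lam).+1 | block_index lam i == l]| =
  nth 0 lam l + (l == 0).
Proof.
move=> llam.
have S_le j : sumn (take j lam) <= sumn lam.
  by rewrite -{2}(cat_take_drop j lam) sumn_cat leq_addr.
rewrite (eq_card (B := [pred i : 'I_(sumn lam).+1 |
  (if l == 0 then 0 else (sumn (take l lam)).+1) <= i <
  (sumn (take l.+1 lam)).+1])); last first.
  move=> i; rewrite !inE block_indexP -1?ltnS //; case: eqP => // ->.
  by rewrite sumn_take1.
rewrite card_ord_interval ?ltnS //; case: eqP => [-> | _].
  by rewrite sumn_take1 subn0 addn1.
by rewrite subSS (take_nth 0 llam) -cats1 sumn_cat /= addKn addn0.
Qed.

(** Equal fibre sizes mean that the two tuples of values are rearrangements of each other. *)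
Lemma perm_of_fibres (T : eqType) N (f h : 'I_N -> T) :
  (forall l, #|[pred i | f i == l]| = #|[pred i | h i == l]|) ->
  exists w : 'S_N, forall i, f (w i) = h i.
Proof.
move=> fh; have : perm_eq [tuple h i | i < N] [tuple f i | i < N].
  have cnt (u : 'I_N -> T) l : count_mem l (mktuple u) = #|[pred i | u i == l]|.
    by rewrite count_map val_ord_tuple enumT cardE size_filter.
  by apply/allP => l _ /=; rewrite !cnt fh.
case/tuple_permP => w e; exists w => i.
have /(congr1 (fun t => tnth t i)) := val_inj e.
by rewrite !tnth_mktuple => ->.
Qed.

End Blocks.

(** * Action of the equivalence moves *)

Section Images.

Variables (F : fieldType) (n m : nat).

Lemma mem_limg_can (vT : vectType F) (f f' : 'End(vT)) (U : {vspace vT}) x :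
  cancel f f' -> cancel f' f -> (x \in (f @: U)%VS) = (f' x \in U).
Proof.
move=> fK f'K; apply/memv_imgP/idP => [[u Uu ->] | Ux]; first by rewrite fK.
by exists (f' x); rewrite // f'K.
Qed.

Lemma neg_trmxE (A : 'M[F]_n) : neg_trmx F n A = - A^T.
Proof. by rewrite opp_lfunE lfunE. Qed.

Lemma neg_trmxK : involutive (neg_trmx F n).
Proof. by move=> A; rewrite !neg_trmxE linearN /= trmxK opprK. Qed.

(** The map is -1 on diagonal matrices, so it preserves every subspace [s] of the Cartan subalgebra,
    and it exchanges the lines of [E_ij] and [E_ji]. *)
Lemma neg_trmx_weight_sum (s : {vspace 'M[F]_n}) (P : rel 'I_n) :
  (s <= cartan F n)%VS ->
  (neg_trmx F n @: weight_sum s P)%VS = weight_sum s (fun i j => P j i).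
Proof.
move=> sh; apply/vspaceP => A; rewrite (mem_limg_can _ _ neg_trmxK neg_trmxK).
have dN : diag_part (neg_trmx F n A) = - diag_part A.
  apply/matrixP => i j; rewrite neg_trmxE !(diag_partE, mxE) mulNrn.
  by have [-> | ] := eqVneq i j.
apply/mem_weight_sum/mem_weight_sum => //; rewrite dN memvN => -[dA A0];
  split=> // i j nij nP.
  have := A0 j i; rewrite neg_trmxE !mxE eq_sym => /(_ nij nP)/eqP.
  by rewrite oppr_eq0 => /eqP.
by rewrite neg_trmxE !mxE A0 ?oppr0 // eq_sym.
Qed.

Lemma perm_conjE (w : 'S_n) (A : 'M[F]_n) i j :
  perm_conj F w A i j = A (w i) (w j).
Proof.
have invP : invmx (perm_mx w) = perm_mx w^-1 :> 'M[F]_n.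
  by rewrite -[RHS](mulKmx (unitmx_perm F w)) -perm_mxM mulgV perm_mx1 mulmx1.
by rewrite lfunE /= invP -col_permE -row_permE !mxE.
Qed.

End Images.

Section Renaming.

Variables (F : fieldType) (n m : nat).
Implicit Types (W : 'M[F]_n.+1) (w : 'S_n.+1).

Lemma eq_rows m' (r : 'I_n.+1 -> 'I_m) (r' : 'I_n.+1 -> 'I_m') W A A' :
  (forall i, A (r i) = A' (r' i)) -> rows r W A = rows r' W A'.
Proof.
move=> eA; rewrite /rows /row_cartan (eq_bigl (fun i => A' (r' i))) //.
exact: eq_weight_sum.
Qed.

Lemma perm_conj_delta w i j :
  perm_conj F w (delta_mx (w i) (w j)) = delta_mx i j.
Proof. by apply/matrixP => k l; rewrite perm_conjE !mxE !(inj_eq perm_inj). Qed.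

Lemma perm_conj_rows w (r : 'I_n.+1 -> 'I_m) W A :
  (perm_conj F w @: rows r W A)%VS =
  rows (fun i => r (w i)) (perm_conj F w W) A.
Proof.
rewrite limgD; congr (_ + _)%VS.
  rewrite limg_sum /row_cartan (reindex_inj (@perm_inj _ w)) /=.
  apply: eq_bigr => i _.
  by rewrite limg_line /unit_diff linearB /= perm_conj_delta.
rewrite limg_span -map_comp; apply: eq_span => x; apply/mapP/mapP => -[[i j]];
  rewrite mem_enum inE /= => /andP[nij Ai] ->.
  exists ((w^-1)%g i, (w^-1)%g j); last first.
    by rewrite -[in RHS](perm_conj_delta w) !permKV.
  by rewrite mem_enum inE /= permKV (inj_eq perm_inj) nij.
exists (w i, w j); last by rewrite /= perm_conj_delta.
by rewrite mem_enum inE /= (inj_eq perm_inj) nij.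
Qed.

End Renaming.

Section NormalForm.

Variables (F : fieldType) (n m : nat).
Implicit Types (lam : seq nat) (W X : 'M[F]_n.+1) (l : 'I_m.+1).

(** When [size lam = m.+1] and [sumn lam = n], the block index is below [m.+1], so [inord] does not
    alter it. *)
Definition block_colour lam (i : 'I_n.+1) :
  'I_m.+1 := inord (block_index lam i).

Lemma block_colourP lam i l : size lam = m.+1 -> sumn lam = n ->
  (block_colour lam i == l) =
  if val l == 0%N then (i <= nth 0 lam 0)%N else block lam l i.
Proof.
move=> szl suml; have il : (i <= sumn lam)%N by rewrite suml -ltnS.
rewrite -val_eqE /= inordK; first by rewrite block_indexP ?szl.
by rewrite -szl block_index_lt // -size_eq0 szl.
Qed.

Lemma card_block_colour lam l : size lam = m.+1 -> sumn lam = n ->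
  #|[pred i | block_colour lam i == l]| = (nth 0 lam l + (val l == 0))%N.
Proof.
move=> szl suml; rewrite -card_block_index ?szl // suml.
apply: eq_card => i; rewrite !inE block_colourP // block_indexP ?szl //.
by rewrite suml -ltnS.
Qed.

Lemma block_colour0 lam : size lam = m.+1 -> sumn lam = n ->
  block_colour lam 0 = 0.
Proof. by move=> szl suml; apply/eqP; rewrite block_colourP. Qed.

Lemma root_vectorsP (P : pred 'I_n.+1) (x : 'M[F]_n.+1) :
  reflect (exists i j, [/\ i != j, P i & x = delta_mx i j])
          (x \in root_vectors F P).
Proof.
apply: (iffP allpairsPdep) => [[i [j []]] | [i [j [nij Pi ->]]]].
  by rewrite !mem_enum !inE => Pi nji ->; exists i, j; rewrite eq_sym nji.
by exists i, j; rewrite !mem_enum !inE eq_sym.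
Qed.

(** With [X = e_0 - W] one has [H_i = X - (e_i - W)]: in block 0 the matrices [X] and [H_i] span the
    same space as the [e_i - W], and in the other blocks [H_i - X] is [-(e_i - W)]. *)
Lemma normal_form_eq_rows lam W l : size lam = m.+1 -> sumn lam = n ->
  normal_form_eq lam (unit_diff W 0) l = rows (block_colour lam) W (pred1 l).
Proof.
move=> szl suml; rewrite /normal_form_eq.
have Hu i : Hmat F i = unit_diff W 0 - unit_diff W i.
  by rewrite /unit_diff opprB addrA subrK.
have cP i := block_colourP i l szl suml.
have rowsE : rows (block_colour lam) W (pred1 l) =
    (<<root_vectors F [pred i | block_colour lam i == l]>> +
     \sum_(i | block_colour lam i == l) <[unit_diff W i]>)%VS.
  rewrite addvC; congr (_ + _)%VS; apply: eq_span => x.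
  apply/mapP/root_vectorsP => [[[i j]] | [i [j [nij Pi ->]]]].
    by rewrite mem_enum inE /= => /andP[nij Pi] ->; exists i, j.
  by exists (i, j) => //; rewrite mem_enum inE /= nij.
rewrite {}rowsE; case: ifPn => l0.
  rewrite span_cons span_cat addvA [(<[_]> + _)%VS]addvC -addvA;
    congr (_ + _)%VS.
    apply: eq_span => x; apply/root_vectorsP/root_vectorsP =>
      -[i [j [nij Pi ->]]];
      by exists i, j; split=> //; move: Pi; rewrite /= cP l0.
  apply/eqP; rewrite eqEsubv subv_add; apply/andP; split; first (apply/andP;
    split).
  - by apply: (sumv_sup 0); rewrite ?cP ?l0.
  - apply/span_subvP => _ /imageP[i + ->]; rewrite inE => ile; rewrite Hu.
    by apply: memvB; rewrite memvE; [apply: (sumv_sup 0)|apply: (sumv_sup i)];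
      rewrite ?cP ?l0.
  apply/subv_sumP => i; rewrite cP l0 => ile; rewrite -memvE.
  rewrite -[unit_diff W i](subKr (unit_diff W 0)) -Hu; apply: memvB.
    by rewrite (subvP (addvSl _ _)) ?memv_line.
  apply: (subvP (addvSr _ _)); apply: memv_span; apply/imageP.
  by exists i.
rewrite span_cat; congr (_ + _)%VS.
  apply: eq_span => x; apply/root_vectorsP/root_vectorsP =>
    -[i [j [nij Pi ->]]];
    by exists i, j; split=> //; move: Pi; rewrite /= cP (negPf l0).
have HX i : Hmat F i - unit_diff W 0 = - unit_diff W i.
  by rewrite Hu addrAC subrr sub0r.
apply/eqP; rewrite eqEsubv; apply/andP; split.
  apply/span_subvP => _ /imageP[i + ->]; rewrite inE => bl;
    rewrite HX memvN memvE.
  by apply: (sumv_sup i); rewrite ?cP ?(negPf l0).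
apply/subv_sumP => i; rewrite cP (negPf l0) => bl.
rewrite -memvE -memvN; apply: memv_span; apply/imageP.
by exists i; rewrite ?HX.
Qed.

(** This is the case [X = 0], that is [W = e_0], of the other normal form, with a prepended part 0
    whose block consists of the index 0 alone. *)
Lemma normal_form_succ_rows lam W l : size lam = m -> sumn lam = n ->
  unit_diff W 0 = 0 ->
  normal_form_succ F n lam l = rows (block_colour (0%N :: lam)) W (pred1 l).
Proof.
move=> szl suml u0.
rewrite -normal_form_eq_rows /= ?szl ?add0n // u0.
rewrite /normal_form_eq /normal_form_succ; case: l => -[|l] ltl /=.
  apply/eqP; rewrite eqEsubv; apply/andP; split; apply/span_subvP => x.
    case/imageP => j; rewrite !inE => nj0 ->; apply: memv_span.
    rewrite inE mem_cat; apply/orP; right; apply/orP; left.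
    by apply/root_vectorsP; exists 0, j; rewrite eq_sym.
  rewrite inE mem_cat => /or3P[/eqP-> | /root_vectorsP[i [j [nij + ->]]] |].
  - exact: mem0v.
  - rewrite /= leqn0 => /eqP i0; apply: memv_span; apply/imageP.
    have {}i0 : i = ord0 by apply: val_inj.
    by exists j; rewrite ?i0 // inE eq_sym -i0.
  case/imageP => i; rewrite inE leqn0 => /eqP i0 ->.
  have -> : i = ord0 by apply: val_inj.
  by rewrite /Hmat subrr mem0v.
by congr <<_ ++ _>>%VS; apply: eq_map => i; rewrite subr0.
Qed.

End NormalForm.

(** * Reduction to sorted rows *)

Section Classification.

Variables (F : fieldType) (n m : nat).
Hypothesis charF : [pchar F] =i pred0.
Implicit Types (g : 'I_m.+1 -> {vspace 'M[F]_n.+1}) (W : 'M[F]_n.+1).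
Implicit Types (r : 'I_n.+1 -> 'I_m.+1) (l : 'I_m.+1).

Lemma regular_row_form k g : (1 < m)%N -> regular_decomposition k g ->
  exists r W l0 g',
    [/\ row_datum r W l0, equivalent g g',
        forall l, g' l = rows r W (pred1 l) &
        k = if (1 < #|[pred i | r i == l0]|)%N then m.+1 else m].
Proof.
move=> m1 reg; have [s [c [col clc gE <-]]] := regular_coloured charF reg.
have [_ _ g0 _ _] := reg.
have used l : exists i j, i <> j /\ c i j = l.
  by apply: (coloured_used col); rewrite -gE.
(* Every summand is nonzero, so all [m.+1 >= 3] colours occur on off-diagonal pairs. *)
have three (t : seq 'I_m.+1) :
  (size t < 3)%N -> exists i j, i <> j /\ c i j \notin t.
  move=> szt; have [l lt] : exists l, l \notin t.
    apply/existsP; apply: contraLR szt => /existsPn all_t; rewrite -leqNgt.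
    have: (#|'I_m.+1| <= size t)%N.
      apply: leq_trans (card_size t); apply: subset_leq_card.
      by apply/subsetP => l _; have := all_t l; rewrite negbK.
    by rewrite card_ord; apply: leq_trans.
  by have [i [j [nij cij]]] := used l; exists i, j; rewrite cij.
have fin s' r : coloured s' (fun i _ => r i) -> s' = s ->
    (forall l, exists i, r i = l) ->
    exists W l0, [/\ row_datum r W l0,
      forall l, s l = row_cartan r W (pred1 l) &
      #|[set l | s l != 0%VS]| =
      if (1 < #|[pred i | r i == l0]|)%N then m.+1 else m].
  move=> col' es surj; rewrite -{}es.
  have [W [l0 [rW sE]]] := row_coloured col' (fun _ _ _ =>
    erefl) surj (leqW m1).
  exists W, l0; split=> //; rewrite -[m in RHS]/(m.+1.-1) -(card_row_cartan rW).
  by apply: eq_card => l; rewrite !inE sE.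
have [sh dxs sums cor] := col.
have [[r rc] | [r rc]] := three_colouring clc three.
  have [|||W [l0 [rW sE ek]]] := fin s r.
  - split=> // i j nij; have nji : j != i by rewrite eq_sym.
    by rewrite -(rc i j (elimN eqP nij)) -(rc j i (elimN eqP nji)) cor.
  - by [].
  - by move=> l; have [i [j [nij cij]]] := used l; exists i; rewrite -(rc i j).
  exists r, W, l0, g; split=> //; first exact: rst_refl.
  move=> l; rewrite gE /rows -sE; apply: eq_weight_sum => i j nij /=.
  by rewrite (rc i j (elimN eqP nij)).
(* A column colouring becomes a row colouring under the swap, with the same Cartan parts [s]. *)
have [|||W [l0 [rW sE ek]]] := fin s r.
- split=> // i j nij; have nji : j != i by rewrite eq_sym.
  by rewrite -(rc i j (elimN eqP nij)) -(rc j i (elimN eqP nji)) addvC cor.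
- by [].
- move=> l; have [i [j [nij cij]]] := used l; exists j; rewrite -(rc j i) //.
  exact/nesym.
exists r, W, l0, (fun l => (neg_trmx F n.+1 @: g l)%VS); split=> //.
  by apply: rst_step; apply: StepSwap.
move=> l; rewrite gE neg_trmx_weight_sum // /rows -sE.
by apply: eq_weight_sum => i j nij /=; rewrite (rc i j (elimN eqP nij)).
Qed.

Lemma row_form_sort r W l0 g : row_datum r W l0 ->
  (forall l, g l = rows r W (pred1 l)) ->
  exists lam W' g',
    [/\ [/\ size lam = m.+1, sumn lam = n,
            nth 0%N lam 0 = #|[pred i | r i == l0]|.-1 &
            forall l, l != 0 -> (0 < nth 0%N lam l)%N],
        row_datum (block_colour m lam) W' 0, equivalent g g' &
        forall l, g' l = rows (block_colour m lam) W' (pred1 l)].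
Proof.
move=> rW gE; have [dW trW W0 surj] := rW.
(* Renumbering by [t] gives the distinguished colour [l0] the number 0. *)
pose t := tperm (0 : 'I_m.+1) l0.
have tK l : t (t l) = l by rewrite /t tpermK.
pose mu l := #|[pred i | r i == t l]|.
have mu0 l : (0 < mu l)%N.
  by have [i ri] := surj (t l); apply/card_gt0P; exists i; rewrite inE ri.
(* One is subtracted for colour 0, since block 0 has one more index than the first part of [lam]. *)
pose lam := [seq (mu l - (l == 0%N :> nat))%N | l <- enum 'I_m.+1].
have szl : size lam = m.+1 by rewrite size_map size_enum_ord.
have lamE l : nth 0%N lam l = (mu l - (l == 0%N :> nat))%N.
  by rewrite (nth_map l) ?size_enum_ord // nth_ord_enum.
have suml : sumn lam = n.
  have : (\sum_l mu l = n.+1)%N.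
    rewrite -[RHS]card_ord -sum1_card (partition_big r xpredT) //=.
    rewrite [RHS](reindex_inj (@perm_inj _ t)) /=.
    by apply: eq_bigr => l _; rewrite sum1_card.
  rewrite sumnE big_map big_enum /=.
  have -> : (\sum_l mu l = \sum_(l < m.+1) (mu l - (l == 0%N :> nat)) +
                           \sum_(l < m.+1) (l == 0%N :> nat))%N.
    rewrite -big_split; apply: eq_bigr => l _ /=.
    by rewrite subnK //; case: eqP => // _; exact: mu0.
  rewrite [X in (_ + X)%N](bigD1 0) //= [X in (_ + (_ + X))%N]big1 ?addn0
    ?addn1; first by case.
  by move=> l; rewrite -val_eqE /= => /negPf ->.
have fibre l : #|[pred i | r i == l]| = #|[pred i :
  'I_n.+1 | t (block_colour m lam i) == l]|.
  have tb (i : 'I_n.+1) : (t (block_colour m lam i) == l) = (block_colour m lam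
    i == t l).
    by rewrite -(inj_eq (@perm_inj _ t)) tK.
  have /eq_card -> : [pred i : 'I_n.+1 | t (block_colour m lam i) == l] =i
      [pred i : 'I_n.+1 | block_colour m lam i == t l].
    by move=> i; rewrite inE [RHS]inE tb.
  rewrite card_block_colour // lamE subnK; last by case: eqP => // _;
    apply: mu0.
  by rewrite /mu tK.
have [w rw] := perm_of_fibres fibre.
pose g1 l := g (t l).
exists lam, (perm_conj F w W), (fun l => (perm_conj F w @: g1 l)%VS); split.
- split=> // [|l nl0]; first by have /= -> := lamE 0;
  rewrite /mu /t tpermL subn1.
  by rewrite lamE (negPf (nl0 : l != 0%N :> nat)) subn0 mu0.
- split.
  + apply/is_diag_mxP => i j nij; rewrite perm_conjE (is_diag_mxP dW) //.
    by rewrite (inj_eq val_inj) (inj_eq perm_inj).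
  + by rewrite -trW /mxtrace [RHS](reindex_inj (@perm_inj _ w));
    apply: eq_bigr => i _; rewrite perm_conjE.
  + move=> i ri; rewrite perm_conjE W0 // rw -[l0](tpermL 0) -/t.
    by rewrite (inj_eq perm_inj).
  move=> l; have [i ri] := surj (t l); exists ((w^-1)%g i).
  by rewrite -[RHS]tK -ri -(permKV w i) rw tK permKV.
- apply: (@rst_trans _ _ g g1); apply: rst_step.
    exact: (@StepRenumber _ _ _ _ _ t).
  exact: (@StepWeyl _ _ _ _ _ w).
move=> l; rewrite /g1 gE perm_conj_rows; apply: eq_rows => i /=.
by rewrite rw (inj_eq perm_inj).
Qed.
End Classification.

(** * The classification *)

Section Types.

Variables (F : fieldType) (n m : nat).
Implicit Types (W X : 'M[F]_n.+1) (lam : seq nat).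

Lemma regular_type_bounds k (g : 'I_m -> {vspace 'M[F]_n.+1}) :
  [pchar F] =i pred0 -> (0 < n)%N -> regular_decomposition k g ->
  (0 < k <= m)%N.
Proof.
move=> charF n0 reg; have [s [c [[_ _ sums _] _ _ <-]]] := regular_coloured
  charF reg.
have := max_card [set l | s l != 0%VS]; rewrite card_ord => ->.
rewrite andbT card_gt0.
apply: contraTneq (coroot_cartan F (0 : 'I_n.+1) ord_max) => s0.
have {s0} s0 l : s l = 0%VS.
  by apply/eqP; move/setP/(_ l): s0; rewrite !inE => /negbFE.
rewrite -sums big1 // memv0; apply/matrix0Pn; exists 0, 0.
have /negPf n0max : (0 : 'I_n.+1) != ord_max by rewrite -val_eqE /= ltn_eqF.
by rewrite !mxE !eqxx n0max subr0 oner_eq0.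
Qed.

(** Once [l0] is colour 0, [W] lives on block 0, so [e_0 - W] falls under the first alternative. *)
Lemma datum_admissible k lam W : size lam = m.+1 -> sumn lam = n ->
  row_datum (block_colour m lam) W 0 -> admissible k lam (unit_diff W 0).
Proof.
move=> szl suml rW; have [_ _ W0 _] := rW; left.
have Xh := unit_diff_cartan rW 0.
rewrite (cartan_sum (delta_mx 0 0) Xh); apply: memv_suml => i _.
have [-> | ni0] := eqVneq i 0;
  first by rewrite [X in _ *: X]subrr scaler0 mem0v.
have [ri | nri] := eqVneq (block_colour m lam i) 0; last first.
  by rewrite !mxE W0 // (negPf ni0) subr0 scale0r mem0v.
apply: memvZ; rewrite -memvN opprB; apply: memv_span; apply/imageP;
  exists i => //.
rewrite inE lt0n; apply/andP; split=> //.
by move/eqP: ri; rewrite block_colourP.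
Qed.

(** For [X] in the span take colour 0 as [l0]; for [X = H_p] one gets [W = e_p], and [l0] is the
    block of [p]. Two rows of colour [l0] exist since block 0 has the extra index 0, respectively
    since the part containing [p] exceeds 1. *)
Lemma admissible_datum lam X : size lam = m.+1 -> is_partition n lam ->
  admissible m.+1 lam X ->
  exists2 l0, row_datum (block_colour m lam) (delta_mx 0 0 - X) l0 &
              (1 < #|[pred i : 'I_n.+1 | block_colour m lam i == l0]|)%N.
Proof.
move=> szl [/allP lam1 suml] adm.
have card l := card_block_colour (n := n) l szl suml.
have lam0 (l : 'I_m.+1) : (0 < nth 0%N lam l)%N by apply/lam1/mem_nth;
  rewrite szl.
have r0 := block_colour0 (n := n) szl suml.
have surj (l : 'I_m.+1) : exists i : 'I_n.+1, block_colour m lam i = l.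
  have /card_gt0P[i /eqP ri] : (0 < #|[pred i :
    'I_n.+1 | block_colour m lam i == l]|)%N.
    by rewrite card addn_gt0 lam0.
  by exists i.
have unitD (i : 'I_n.+1) : row_datum (block_colour m lam) (delta_mx i i :
  'M[F]_n.+1)
    (block_colour m lam i).
  split=> //.
  - apply/is_diag_mxP => k l nkl; rewrite mxE.
    by case: andP => // -[/eqP ek /eqP el]; rewrite ek el eqxx in nkl.
  - rewrite /mxtrace (bigD1 i) //= big1 => [|k /negPf nk]; rewrite mxE ?nk //.
    by rewrite !eqxx addr0.
  move=> j nj; rewrite mxE andbb; case: eqP => // eji.
  by rewrite eji eqxx in nj.
case: adm => [Xin | [q [p [/andP[q0 qk] lamq bp ->]]]]; last first.
  have rp : block_colour m lam p = Ordinal qk.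
    by apply/eqP; rewrite block_colourP //= (gtn_eqF q0).
  exists (Ordinal qk); last by rewrite card /= (gtn_eqF q0) addn0.
  by rewrite /Hmat subKr -rp; apply: unitD.
exists 0; last by rewrite card addn1 ltnS lam0.
have := unitD 0; rewrite r0 => rD.
have {Xin} : X \in row_cartan (block_colour m lam) (delta_mx 0 0) (pred1 0).
  apply: subvP Xin; apply/span_subvP => _ /imageP[i + ->].
  rewrite inE => /andP[_ ile]; rewrite -memvN opprB.
  by apply: unit_diff_row_cartan; rewrite /= block_colourP.
move=> Xr; have Xh := subvP (row_cartan_sub rD _) X Xr.
have [dD trD _ _] := rD; split=> //.
- by apply/is_diag_mxP => i j nij; rewrite !mxE (cartan_diag Xh nij) subr0;
    have /is_diag_mxP/(_ i j nij) := dD; rewrite mxE.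
- by rewrite linearB /= trD (trace_cartan Xh) subr0.
move=> i ri; have ni0 : i != 0 by apply: contraNneq ri => ->; rewrite r0.
have [b Xb] := mem_row_cartan _ _ _ _ Xr.
by rewrite !mxE (negPf ni0) Xb row_cartan_entry mxE /= (negPf ri) (negPf ni0)
  mulr0 !subr0.
Qed.

End Types.

Theorem theoremB (F : closedFieldType) (charF : [pchar F] =i pred0)
    (n : nat) (hn : (2 <= n)%N) :
  (forall (m k : nat) (g : 'I_m -> {vspace 'M[F]_n.+1}),
     regular_decomposition k g ->
     [/\ m = k.+1 \/ m = k,
         (3 <= m)%N -> m = k.+1 ->
           exists (lam : k.-tuple nat) (g' : 'I_m -> {vspace 'M[F]_n.+1}),
             [/\ is_partition n lam, equivalent g g' &
                 forall l : 'I_m, g' l = normal_form_succ F n lam l] &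
         (3 <= m)%N -> m = k ->
           exists (lam : k.-tuple nat) (X : 'M[F]_n.+1)
                  (g' : 'I_m -> {vspace 'M[F]_n.+1}),
             [/\ is_partition n lam, admissible k lam X, equivalent g g' &
                 forall l : 'I_m, g' l = normal_form_eq lam X l]])
  /\
  (forall (k : nat) (lam : k.-tuple nat) (X : 'M[F]_n.+1),
     (3 <= k)%N -> is_partition n lam -> admissible k lam X ->
     regular_decomposition k (fun l : 'I_k => normal_form_eq lam X l)).
Proof.
have n0 := ltnW hn.
split=> [m k g reg | [//|m] lam X m2 part adm]; last first.
  (* Every admissible [X] occurs: [W = e_0 - X] completes a row datum whose colour [l0] has at least
     two rows, so all [k] Cartan parts are nonzero. *)
  have szl := size_tuple lam; have [_ suml] := part.
  have [l0 rW card1] := admissible_datum szl part adm.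
  have := card_row_cartan rW; rewrite card1 => ek.
  rewrite -[X in regular_decomposition X]ek;
    apply: (rows_regular rW) => // [|l].
    exact: ltnW.
  by rewrite -normal_form_eq_rows // /unit_diff subKr.
have [m2 _ _ _ _] := reg; have kb := regular_type_bounds charF n0 reg.
have [m3 | m2'] := ltnP 2 m; last first.
  split=> //.
  have em : m = 2%N by apply/eqP; rewrite eqn_leq m2'.
  rewrite em in kb *; case: (k) kb => [|[|[|k']]] //; by [left | right].
case: m g reg m2 kb m3 => // m g reg _ kb m3.
have [r [W [l0 [g1 [rW eq1 g1E ek]]]]] := regular_row_form charF m3 reg.
have [lam [W' [g' [[szl suml lam0 lamP] rW' eq2 g'E]]]] := row_form_sort rW g1E.
have eq' : equivalent g g' by apply: rst_trans eq1 eq2.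
have lam_all j : (0 < j < m.+1)%N -> (0 < nth 0%N lam j)%N.
  by case/andP=> j0 jm; apply: (lamP (Ordinal jm)); rewrite -val_eqE /= -lt0n.
split; first by rewrite ek; case: ifP; [right | left].
- move=> _ [emk]; move: ek; rewrite -emk => ek.
  have one : (1 < #|[pred i | r i == l0]|)%N = false.
    by apply: contra_eqF ek => ->; rewrite eqn_leq ltnn andbF.
  (* The colour [l0] has a single row, so the first part is 0; dropping it leaves a partition with
     [k] parts. *)
  have lam00 : nth 0%N lam 0 = 0%N.
    by rewrite lam0; case: #|_| one => [|[|]].
  case: lam szl suml lam00 rW' g'E lam_all {lamP lam0} =>
    // a lam [szl] suml /= a0.
  subst a => rW' g'E lam_all; rewrite /= add0n in suml.
  exists (Tuple (introT eqP szl)), g'; split=> // [|l].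
    split=> //; apply/(all_nthP 0%N) => j jlt.
    by apply: (lam_all j.+1); rewrite ltnS -szl.
  rewrite g'E (normal_form_succ_rows (W := W')) //.
  (* The Cartan part of colour 0 vanishes and contains [e_0 - W'], whence [X = 0]. *)
  have s0 : row_cartan (block_colour m (0%N :: lam)) W' (pred1 0) = 0%VS.
    by apply/eqP; rewrite -[_ == _]negbK (row_cartan_l0_neq0 rW')
      card_block_colour /= ?szl.
  apply/eqP; rewrite -memv0 -s0; apply: unit_diff_row_cartan.
  by rewrite /= block_colour0 //= szl.
move=> _ emk; move: ek; rewrite -emk => ek.
have two : (1 < #|[pred i | r i == l0]|)%N.
  by move: ek; case: ifP => // _ /eqP; rewrite eqn_leq ltnn.
have lam0_gt0 : (0 < nth 0%N lam 0)%N by rewrite lam0 -subn1 subn_gt0.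
exists (Tuple (introT eqP szl)), (unit_diff W' 0), g'; split=> // [||l].
- split=> //; apply/(all_nthP 0%N) => -[|j] // jlt.
  by apply: lam_all; rewrite -szl.
- exact: (datum_admissible _ szl suml rW').
by rewrite g'E normal_form_eq_rows.
Qed.
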